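(* Let $n\ge1$, let $V$ be the two-dimensional standard (type I) representation of $U_q(\mathfrak{gl}_2)$, and let $U^\iota=U_q'(\mathfrak{gl}_1\times\mathfrak{gl}_1)\subseteq U_q(\mathfrak{gl}_2)$. The left action of $U^\iota$ and the right action of the specialized Hecke algebra $\mathcal{H}_{1,q}(B_n)$ on $V^{\otimes n}$ commute and centralize each other, i.e. the image of each algebra in $\mathrm{End}_{\mathbb{C}(q)}(V^{\otimes n})$ is the full centralizer of the image of the other. Moreover there is an isomorphism of $\mathbb{C}(q)$-algebras $$\mathrm{TL}(B_n)\cong\mathrm{End}_{U^\iota}(V^{\otimes n}),$$ where $\mathrm{TL}(B_n)$ is the type $B$ Temperley--Lieb algebra over $\mathbb{C}(q)$ with loop parameter $\delta=-(q+q^{-1})$.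
   Context: Ground field $\mathbb{C}(q)$. $U_q(\mathfrak{gl}_2)$ has generators $E,F,D_1^{\pm1},D_2^{\pm1}$ and relations $D_1D_2=D_2D_1$, $D_iD_i^{-1}=D_i^{-1}D_i=1$, $D_1ED_1^{-1}=qE$, $D_2ED_2^{-1}=q^{-1}E$, $D_1FD_1^{-1}=q^{-1}F$, $D_2FD_2^{-1}=qF$, $EF-FE=\frac{K-K^{-1}}{q-q^{-1}}$ with $K=D_1D_2^{-1}$; comultiplication $\Delta(E)=E\otimes1+K\otimes E$, $\Delta(F)=F\otimes K^{-1}+1\otimes F$, $\Delta(D_i)=D_i\otimes D_i$. $V$ has basis $x,y$ with $Ey=x$, $Ex=0$, $Fx=y$, $Fy=0$, $D_1x=qx$, $D_1y=y$, $D_2x=x$, $D_2y=qy$. $U^\iota$ is the subalgebra generated by $C^{\pm1}$, $C=D_1D_2$, and $B=q^{-1}EK^{-1}+F$; it acts on $V^{\otimes n}$ by restriction from $U_q(\mathfrak{gl}_2)$. $\mathcal{H}_{1,q}(B_n)$ is the $\mathbb{C}(q)$-algebra with generators $s_0=H_0,H_1,\dots,H_{n-1}$ and relations $H_0^2=1$; $H_i^2=1+(q^{-1}-q)H_i$ for $1\le i\le n-1$; $H_0H_1H_0H_1=H_1H_0H_1H_0$; $H_iH_{i+1}H_i=H_{i+1}H_iH_{i+1}$ for $1\le i\le n-2$; $H_iH_j=H_jH_i$ for $|i-j|\ge2$. It acts from the right on $V^{\otimes n}$: $s_0$ exchanges $x$ and $y$ in the first tensor factor, and $H_i$ ($i\ge1$)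 acts on the $i$-th and $(i+1)$-st tensor factors by $(x\otimes x)H_i=q^{-1}x\otimes x$, $(x\otimes y)H_i=y\otimes x$, $(y\otimes x)H_i=x\otimes y+(q^{-1}-q)\,y\otimes x$, $(y\otimes y)H_i=q^{-1}y\otimes y$. $\mathrm{TL}(B_n)=\mathrm{TL}(B_n,\delta)$ is the unital associative algebra with generators $s_0,U_1,\dots,U_{n-1}$ and relations $U_i^2=\delta U_i$; $U_iU_{i+1}U_i=U_i$ and $U_{i+1}U_iU_{i+1}=U_{i+1}$ for $1\le i\le n-2$; $U_iU_j=U_jU_i$ for $|i-j|\ge2$; $s_0^2=1$; $U_1s_0U_1=0$; $s_0U_i=U_is_0$ for $i\ge2$. *)

(* Defs.v *)
From HB Require Import structures.
From mathcomp Require Import all_boot all_algebra generic_quotient.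
From mathcomp Require Import boolp classical_sets reals.
From mathcomp.real_closed Require Import complex mxtens.
From mathcomp Require Import ring.

Set Implicit Arguments.
Unset Strict Implicit.
Unset Printing Implicit Defensive.

Import GRing.Theory.
Local Open Scope ring_scope.
Local Open Scope quotient_scope.

(* Formal expressions of the free associative unital K-algebra on G. *)
Inductive pexpr (K G : Type) : Type :=
| TVar of G
| TZero
| TOne
| TOpp of pexpr K G
| TAdd of pexpr K G & pexpr K G
| TMul of pexpr K G & pexpr K G
| TScale of K & pexpr K G.
Arguments TVar {K G} _.
Arguments TZero {K G}.
Arguments TOne {K G}.

Declare Scope pexpr_scope.
Delimit Scope pexpr_scope with px.
Bind Scope pexpr_scope with pexpr.
Notation "0" := TZero : pexpr_scope.
Notation "1" := TOne : pexpr_scope.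
Notation "- a" := (TOpp a) : pexpr_scope.
Notation "a + b" := (TAdd a b) : pexpr_scope.
Notation "a - b" := (TAdd a (TOpp b)) : pexpr_scope.
Notation "a * b" := (TMul a b) : pexpr_scope.
Notation "c *: a" := (TScale c%R a) : pexpr_scope.

HB.instance Definition _ (K G : Type) := gen_eqMixin (pexpr K G).
HB.instance Definition _ (K G : Type) := gen_choiceMixin (pexpr K G).

Section Presentation.
Variables (K : fieldType) (G : Type).
Local Notation pexpr := (pexpr K G).

Fixpoint eval (A : algType K) (f : G -> A) (t : pexpr) : A :=
  match t with
  | TVar g => f g
  | TZero => 0
  | TOne => 1
  | TOpp a => - eval f a
  | TAdd a b => eval f a + eval f b
  | TMul a b => eval f a * eval f b
  | TScale k a => k *: eval f a
  end.

Definition satisfies (A : algType K) (r : pexpr -> pexpr -> Prop) (f : G -> A) :=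
  forall a b, r a b -> eval f a = eval f b.

(* A one-dimensional representation is recorded with the relations because  *)
(* [algType] requires 1 != 0; the presented algebra does not depend on it.  *)
Record presentation := Presentation {
  relations : pexpr -> pexpr -> Prop;
  character : G -> K^o;
  characterP : satisfies relations character }.

Variable P : presentation.

Inductive cong : pexpr -> pexpr -> Prop :=
| cong_rel a b : relations P a b -> cong a b
| cong_refl a : cong a a
| cong_sym a b : cong a b -> cong b a
| cong_trans a b c : cong a b -> cong b c -> cong a c
| cong_opp a a' : cong a a' -> cong (- a)%px (- a')%px
| cong_add a a' b b' : cong a a' -> cong b b' -> cong (a + b)%px (a' + b')%px
| cong_mul a a' b b' : cong a a' -> cong b b' -> cong (a * b)%px (a' * b')%px
| cong_scale k a a' : cong a a' -> cong (k *: a)%px (k *: a')%px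
| cong_addA a b c : cong (a + (b + c))%px (a + b + c)%px
| cong_addC a b : cong (a + b)%px (b + a)%px
| cong_add0 a : cong (0 + a)%px a
| cong_addN a : cong (- a + a)%px 0%px
| cong_mulA a b c : cong (a * (b * c))%px (a * b * c)%px
| cong_mul1l a : cong (1 * a)%px a
| cong_mul1r a : cong (a * 1)%px a
| cong_mulDl a b c : cong ((a + b) * c)%px (a * c + b * c)%px
| cong_mulDr a b c : cong (a * (b + c))%px (a * b + a * c)%px
| cong_scaleA k l a : cong (k *: (l *: a))%px ((k * l) *: a)%px
| cong_scale1 a : cong (1 *: a)%px a
| cong_scaleDr k a b : cong (k *: (a + b))%px (k *: a + k *: b)%px
| cong_scaleDl k l a : cong ((k + l) *: a)%px (k *: a + l *: a)%px
| cong_scaleAl k a b : cong (k *: (a * b))%px ((k *: a) * b)%px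
| cong_scaleAr k a b : cong (k *: (a * b))%px (a * (k *: b))%px.

Definition congb (a b : pexpr) : bool := `[< cong a b >].

Lemma congb_equiv : equiv_class_of congb.
Proof.
split=> [a|a b|b a c].
- by apply/asboolP; exact: cong_refl.
- by apply/asboolP/asboolP; exact: cong_sym.
- by move=> /asboolP ab /asboolP bc; apply/asboolP; exact: cong_trans ab bc.
Qed.

Canonical congb_equivRel := EquivRelPack congb_equiv.

(* The associative unital K-algebra with generators G and relations P: the   *)
(* free algebra modulo the ideal generated by the relations.                 *)
Definition presented := {eq_quot congb}.

HB.instance Definition _ : EqQuotient _ congb presented :=
  EqQuotient.on presented.
HB.instance Definition _ := Choice.on presented.

Lemma pi_eqP (a b : pexpr) :
  \pi_presented a = \pi_presented b <-> cong a b.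
Proof.
split=> [|ab]; last by apply/eqquotP/asboolP.
by move=> /eqquotP/asboolP.
Qed.

Lemma reprP (a : pexpr) : cong (repr (\pi_presented a)) a.
Proof. by apply/pi_eqP; rewrite reprK. Qed.

Definition pr_opp (x : presented) := locked (\pi_presented (- repr x)%px).
Definition pr_add (x y : presented) := locked (\pi_presented (repr x + repr y)%px).
Definition pr_mul (x y : presented) := locked (\pi_presented (repr x * repr y)%px).
Definition pr_scale k (x : presented) := locked (\pi_presented (k *: repr x)%px).

Lemma pr_oppE a : pr_opp (\pi_presented a) = \pi_presented (- a)%px.
Proof. by rewrite /pr_opp /pr_add /pr_mul /pr_scale -lock; apply/pi_eqP/cong_opp/reprP. Qed.
Lemma pr_addE a b : pr_add (\pi_presented a) (\pi_presented b) = \pi_presented (a + b)%px.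
Proof. by rewrite /pr_opp /pr_add /pr_mul /pr_scale -lock; apply/pi_eqP/cong_add; exact: reprP. Qed.
Lemma pr_mulE a b : pr_mul (\pi_presented a) (\pi_presented b) = \pi_presented (a * b)%px.
Proof. by rewrite /pr_opp /pr_add /pr_mul /pr_scale -lock; apply/pi_eqP/cong_mul; exact: reprP. Qed.
Lemma pr_scaleE k a : pr_scale k (\pi_presented a) = \pi_presented (k *: a)%px.
Proof. by rewrite /pr_opp /pr_add /pr_mul /pr_scale -lock; apply/pi_eqP/cong_scale/reprP. Qed.
Let prE := (pr_oppE, pr_addE, pr_mulE, pr_scaleE).

Lemma pr_addA : associative pr_add.
Proof.
elim/quotW=> a; elim/quotW=> b; elim/quotW=> c; rewrite !prE.
apply/pi_eqP; exact: cong_addA.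
Qed.
Lemma pr_addC : commutative pr_add.
Proof. by elim/quotW=> a; elim/quotW=> b; rewrite !prE; apply/pi_eqP; exact: cong_addC. Qed.
Lemma pr_add0 : left_id (\pi_presented 0%px) pr_add.
Proof. by elim/quotW=> a; rewrite !prE; apply/pi_eqP; exact: cong_add0. Qed.
Lemma pr_addN : left_inverse (\pi_presented 0%px) pr_opp pr_add.
Proof. by elim/quotW=> a; rewrite !prE; apply/pi_eqP; exact: cong_addN. Qed.

HB.instance Definition _ :=
  GRing.isZmodule.Build presented pr_addA pr_addC pr_add0 pr_addN.

Lemma pr_mulA : associative pr_mul.
Proof.
elim/quotW=> a; elim/quotW=> b; elim/quotW=> c; rewrite !prE.
apply/pi_eqP; exact: cong_mulA.
Qed.
Lemma pr_mul1l : left_id (\pi_presented 1%px) pr_mul.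
Proof. by elim/quotW=> a; rewrite !prE; apply/pi_eqP; exact: cong_mul1l. Qed.
Lemma pr_mul1r : right_id (\pi_presented 1%px) pr_mul.
Proof. by elim/quotW=> a; rewrite !prE; apply/pi_eqP; exact: cong_mul1r. Qed.
Lemma pr_mulDl : left_distributive pr_mul +%R.
Proof.
elim/quotW=> a; elim/quotW=> b; elim/quotW=> c.
rewrite /GRing.add /= !prE; apply/pi_eqP; exact: cong_mulDl.
Qed.
Lemma pr_mulDr : right_distributive pr_mul +%R.
Proof.
elim/quotW=> a; elim/quotW=> b; elim/quotW=> c.
rewrite /GRing.add /= !prE; apply/pi_eqP; exact: cong_mulDr.
Qed.

Lemma eval_cong (A : algType K) (f : G -> A) :
  satisfies (relations P) f -> forall a b, cong a b -> eval f a = eval f b.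
Proof.
move=> fP a b; elim=> //=.
- by move=> x y z _ -> _ ->.
- by move=> x x' _ ->.
- by move=> x x' y y' _ -> _ ->.
- by move=> x x' y y' _ -> _ ->.
- by move=> k x x' _ ->.
- by move=> x y z; rewrite addrA.
- by move=> x y; rewrite addrC.
- by move=> x; rewrite add0r.
- by move=> x; rewrite addNr.
- by move=> x y z; rewrite mulrA.
- by move=> x; rewrite mul1r.
- by move=> x; rewrite mulr1.
- by move=> x y z; rewrite mulrDl.
- by move=> x y z; rewrite mulrDr.
- by move=> k l x; rewrite scalerA.
- by move=> x; rewrite scale1r.
- by move=> k x y; rewrite scalerDr.
- by move=> k l x; rewrite scalerDl.
- by move=> k x y; rewrite scalerAl.
- by move=> k x y; rewrite scalerAr.
Qed.

Lemma pr_oner_neq0 : \pi_presented 1%px != 0.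
Proof.
apply/eqP=> /pi_eqP/(eval_cong (@characterP P))/eqP /=.
by rewrite oner_eq0.
Qed.

HB.instance Definition _ := GRing.Zmodule_isNzRing.Build presented
  pr_mulA pr_mul1l pr_mul1r pr_mulDl pr_mulDr pr_oner_neq0.

Lemma pr_scaleA k l x : pr_scale k (pr_scale l x) = pr_scale (k * l) x.
Proof. by elim/quotW: x => a; rewrite !prE; apply/pi_eqP; exact: cong_scaleA. Qed.
Lemma pr_scale1 : left_id 1 pr_scale.
Proof. by elim/quotW=> a; rewrite !prE; apply/pi_eqP; exact: cong_scale1. Qed.
Lemma pr_scaleDr : right_distributive pr_scale +%R.
Proof.
move=> k; elim/quotW=> a; elim/quotW=> b.
rewrite /GRing.add /= !prE; apply/pi_eqP; exact: cong_scaleDr.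
Qed.
Lemma pr_scaleDl x : {morph pr_scale^~ x : k l / k + l}.
Proof.
elim/quotW: x => a k l; rewrite /= [RHS]/GRing.add /= !prE.
apply/pi_eqP; exact: cong_scaleDl.
Qed.

HB.instance Definition _ := GRing.Zmodule_isLmodule.Build K presented
  pr_scaleA pr_scale1 pr_scaleDr pr_scaleDl.

Lemma pr_scaleAl k (x y : presented) : k *: (x * y) = (k *: x) * y.
Proof.
elim/quotW: x => a; elim/quotW: y => b.
rewrite /GRing.scale /GRing.mul /= !prE; apply/pi_eqP; exact: cong_scaleAl.
Qed.
HB.instance Definition _ :=
  GRing.Lmodule_isLalgebra.Build K presented pr_scaleAl.

Lemma pr_scaleAr k (x y : presented) : k *: (x * y) = x * (k *: y).
Proof.
elim/quotW: x => a; elim/quotW: y => b.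
rewrite /GRing.scale /GRing.mul /= !prE; apply/pi_eqP; exact: cong_scaleAr.
Qed.
HB.instance Definition _ :=
  GRing.Lalgebra_isAlgebra.Build K presented pr_scaleAr.

Definition gen (g : G) : presented := \pi_presented (TVar g).

Lemma eval_gen (t : pexpr) : eval gen t = \pi_presented t.
Proof.
elim: t => //= [a ->|a -> b ->|a -> b ->|k a ->].
- by rewrite /GRing.opp /= prE.
- by rewrite /GRing.add /= prE.
- by rewrite /GRing.mul /= prE.
- by rewrite /GRing.scale /= prE.
Qed.

Lemma gen_satisfies : satisfies (relations P) gen.
Proof. by move=> a b ab; rewrite !eval_gen; apply/pi_eqP; exact: cong_rel. Qed.

Section Lift.
Variables (A : algType K) (f : G -> A) (fP : satisfies (relations P) f).

(* The unused proof argument keys the morphism structures below.             *)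
Definition lift of satisfies (relations P) f :=
  fun x : presented => eval f (repr x).

Lemma lift_pi a : lift fP (\pi_presented a) = eval f a.
Proof. exact/(eval_cong fP)/reprP. Qed.

Lemma lift_gen g : lift fP (gen g) = f g.
Proof. exact: lift_pi. Qed.

Lemma lift_linear : linear (lift fP).
Proof.
move=> k x y; elim/quotW: x => a; elim/quotW: y => b.
by rewrite !lift_pi /GRing.add /GRing.scale /= !prE lift_pi.
Qed.
HB.instance Definition _ := GRing.isLinear.Build K presented A *:%R (lift fP)
  lift_linear.

Lemma lift_monoid_morphism : monoid_morphism (lift fP).
Proof.
split=> [|x y]; first exact: lift_pi.
elim/quotW: x => a; elim/quotW: y => b.
by rewrite !lift_pi /GRing.mul /= !prE lift_pi.
Qed.
HB.instance Definition _ := GRing.isMonoidMorphism.Build presented A (lift fP)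
  lift_monoid_morphism.

End Lift.

End Presentation.

Lemma eval_morph (K : fieldType) (G : Type) (A B : algType K)
    (h : {lrmorphism A -> B}) (f : G -> A) t :
  eval (fun g => h (f g)) t = h (eval f t).
Proof.
elim: t => //= [||a ->|a -> b ->|a -> b ->|k a ->].
- by rewrite rmorph0.
- by rewrite rmorph1.
- by rewrite rmorphN.
- by rewrite rmorphD.
- by rewrite rmorphM.
- by rewrite linearZ.
Qed.

(* The unital subalgebra generated by S. *)
Inductive subalgebra_gen (K : fieldType) (A : algType K) (S : set A) : set A :=
| subalgebra_in u of S u : subalgebra_gen S u
| subalgebra_1 : subalgebra_gen S 1
| subalgebra_lin k u v of subalgebra_gen S u & subalgebra_gen S v :
    subalgebra_gen S (k *: u + v)
| subalgebra_mul u v of subalgebra_gen S u & subalgebra_gen S v :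
    subalgebra_gen S (u * v).

Definition centralizer (A : nzRingType) (S : set A) : set A :=
  [set a | forall s, S s -> a * s = s * a].

Section ConverseAlgebra.
Variables (K : fieldType) (A : algType K).
HB.instance Definition _ := GRing.Lmodule.on A^c.
Let cscalerAl (k : K) (x y : A^c) : k *: (x * y) = (k *: x : A^c) * y.
Proof. exact: (@scalerAr K A k y x). Qed.
HB.instance Definition _ := GRing.Lmodule_isLalgebra.Build K A^c cscalerAl.
Let cscalerAr (k : K) (x y : A^c) : k *: (x * y) = x * (k *: y : A^c).
Proof. exact: (@scalerAl K A k y x). Qed.
HB.instance Definition _ := GRing.Lalgebra_isAlgebra.Build K A^c cscalerAr.
End ConverseAlgebra.

Fixpoint tdim (n : nat) : nat := if n is m.+1 then (2 * tdim m)%N else 1%N.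

Lemma tdim_gt0 n : (0 < tdim n)%N.
Proof. by elim: n => //= n IH; rewrite muln_gt0. Qed.

(* The n-th tensor power of V = K^2, with tpow n.+1 = V (x) tpow n, as a     *)
(* space of column vectors; its endomorphisms act by left multiplication.    *)
Definition tpow (K : fieldType) (n : nat) := 'cV[K]_(tdim n).
Definition End_tpow (K : fieldType) (n : nat) := 'M[K]_(tdim n).

Section EndAlgebra.
Variables (K : fieldType) (n : nat).
HB.instance Definition _ := GRing.PzRing.on (End_tpow K n).
HB.instance Definition _ := GRing.Lmodule.on (End_tpow K n).
HB.instance Definition _ := GRing.Lmodule.on (tpow K n).
Let End_oner_neq0 : (1 : End_tpow K n) != 0.
Proof.
apply/eqP=> /matrixP/(_ (Ordinal (tdim_gt0 n)) (Ordinal (tdim_gt0 n))).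
by rewrite !mxE eqxx => /eqP; rewrite oner_eq0.
Qed.
HB.instance Definition _ :=
  GRing.PzSemiRing_isNonZero.Build (End_tpow K n) End_oner_neq0.
Let End_scalerAl (k : K) (x y : End_tpow K n) : k *: (x * y) = (k *: x) * y.
Proof. exact: scalemxAl. Qed.
HB.instance Definition _ :=
  GRing.Lmodule_isLalgebra.Build K (End_tpow K n) End_scalerAl.
Let End_scalerAr (k : K) (x y : End_tpow K n) : k *: (x * y) = x * (k *: y).
Proof. exact: scalemxAr. Qed.
HB.instance Definition _ :=
  GRing.Lalgebra_isAlgebra.Build K (End_tpow K n) End_scalerAr.
End EndAlgebra.

Definition vx (K : fieldType) : 'cV[K]_2 := delta_mx 0 0.
Definition vy (K : fieldType) : 'cV[K]_2 := delta_mx 1 0.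

(* [b ~~> v] is the linear map sending the standard basis vector b to v and  *)
(* the other standard basis vectors to 0.                                    *)
Notation "b ~~> v" := (v%R *m (b%R)^T) (at level 45) : ring_scope.

Section QuantumGL2.
Variables (K : fieldType) (q : K).

Inductive uq_letter := LE | LF | LD1 | LD1i | LD2 | LD2i.

Local Notation E := (TVar LE).
Local Notation F := (TVar LF).
Local Notation D1 := (TVar LD1).
Local Notation D1i := (TVar LD1i).
Local Notation D2 := (TVar LD2).
Local Notation D2i := (TVar LD2i).

Local Open Scope pexpr_scope.
Inductive uq_rel : pexpr K uq_letter -> pexpr K uq_letter -> Prop :=
| uq_D1D2 : uq_rel (D1 * D2) (D2 * D1)
| uq_D1D1i : uq_rel (D1 * D1i) 1
| uq_D1iD1 : uq_rel (D1i * D1) 1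
| uq_D2D2i : uq_rel (D2 * D2i) 1
| uq_D2iD2 : uq_rel (D2i * D2) 1
| uq_D1E : uq_rel (D1 * E * D1i) (q *: E)
| uq_D2E : uq_rel (D2 * E * D2i) (q^-1 *: E)
| uq_D1F : uq_rel (D1 * F * D1i) (q^-1 *: F)
| uq_D2F : uq_rel (D2 * F * D2i) (q *: F)
| uq_EF : uq_rel (E * F - F * E)
                 ((q - q^-1)^-1 *: (D1 * D2i - D2 * D1i)).
Local Close Scope pexpr_scope.

Definition uq_counit (A : algType K) (g : uq_letter) : A :=
  match g with LE | LF => 0 | _ => 1 end.

Lemma uq_counitP A : satisfies uq_rel (@uq_counit A).
Proof.
by move=> a b [] /=; rewrite ?mulr1 ?mulr0 ?mul0r ?scaler0 ?subrr ?scaler0.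
Qed.

Definition uq_presentation := Presentation (uq_counitP K^o).
Definition uq := presented uq_presentation.

Definition uE : uq := gen uq_presentation LE.
Definition uF : uq := gen uq_presentation LF.
Definition uD1 : uq := gen uq_presentation LD1.
Definition uD1i : uq := gen uq_presentation LD1i.
Definition uD2 : uq := gen uq_presentation LD2.
Definition uD2i : uq := gen uq_presentation LD2i.
Definition uK : uq := uD1 * uD2i.
Definition uKi : uq := uD2 * uD1i.

(* The comultiplication on generators, a sum of pure tensors being given by  *)
(* the list of its terms.                                                    *)
Definition comul (g : uq_letter) : seq (uq * uq) :=
  match g with
  | LE => [:: (uE, 1); (uK, uE)]
  | LF => [:: (uF, uKi); (1, uF)]
  | LD1 => [:: (uD1, uD1)]
  | LD1i => [:: (uD1i, uD1i)]
  | LD2 => [:: (uD2, uD2)]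
  | LD2i => [:: (uD2i, uD2i)]
  end.

(* U^iota is generated by C, C^-1 and B. *)
Definition uC : uq := uD1 * uD2.
Definition uCi : uq := uD1i * uD2i.
Definition uB : uq := q^-1 *: (uE * uKi) + uF.
Definition Uiota : set uq :=
  subalgebra_gen [set u | [\/ u = uC, u = uCi | u = uB]].

Local Notation x := (vx K).
Local Notation y := (vy K).

Definition std_letter (g : uq_letter) : 'M[K]_2 :=
  match g with
  | LE => y ~~> x
  | LF => x ~~> y
  | LD1 => (x ~~> q *: x) + (y ~~> y)
  | LD1i => (x ~~> q^-1 *: x) + (y ~~> y)
  | LD2 => (x ~~> x) + (y ~~> q *: y)
  | LD2i => (x ~~> x) + (y ~~> q^-1 *: y)
  end.

(* The tensor product of the representations rho and sigma.                  *)
Definition tens_letter n (rho : uq -> 'M[K]_2) (sigma : uq -> End_tpow K n)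
    (g : uq_letter) : End_tpow K n.+1 :=
  \sum_(p <- comul g) rho p.1 *t sigma p.2.

Hypothesis q_neq0 : q != 0.
Hypothesis qV_neq : q - q^-1 != 0.

Lemma std_letterP : satisfies uq_rel std_letter.
Proof.
have ord2 (i j : 'I_2) : (i = 0) + (i = 1).
  by case: i => [[|[|//]]] p; [left|right]; apply/val_inj.
have xx : x^T *m x = 1 by rewrite trmx_delta mul_delta_mx; apply/matrixP=> i j; rewrite !ord1 !mxE eqxx.
have yy : y^T *m y = 1 by rewrite trmx_delta mul_delta_mx; apply/matrixP=> i j; rewrite !ord1 !mxE eqxx.
have xy : x^T *m y = 0 by rewrite trmx_delta mul_delta_mx_0.
have yx : y^T *m x = 0 by rewrite trmx_delta mul_delta_mx_0.
have one : 1 = (x ~~> x) + (y ~~> y) :> 'M_2.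
  rewrite !trmx_delta !mul_delta_mx; apply/matrixP=> i j.
  by case: (ord2 i i) (ord2 j j) => [] -> [] ->; rewrite !mxE /= ?addr0 ?add0r.
have mm (a b c d : 'cV[K]_2) : (a ~~> b) * (c ~~> d) = (c ~~> (b *m (a^T *m d))).
  by rewrite -[_ * _]/(_ *m _) !mulmxA.
have mul1 (a : 'cV[K]_2) : a *m 1 = a by exact: mulmx1.
move=> a b [] /=; rewrite ?one !(mulrDl, mulrDr) !mm -?scalemxAr ?(xx, yy, xy, yx) -?scalemxAr ?mulmx0 ?mul1 ?scaler0 ?mul0mx ?addr0 ?add0r ?mulmx0 ?mul0mx ?addr0 ?add0r -?scalemxAl ?scalerA ?mulVf ?mulfV ?scale1r // -?scalemxAr ?xx ?yy ?xy ?yx -?scalemxAl -?scalemxAr ?mul1 -?scalemxAl ?scalerA ?mulVf ?mulfV ?scale1r ?mulmx0 ?mul0mx ?scaler0 ?mul0mx ?addr0 ?add0r //.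
 rewrite opprD addrACA -!scalerBl -[q^-1 - q]opprB scaleNr scalerBr.
by rewrite !scalerA mulVf // !scale1r.
Qed.

Definition uq_std : uq -> 'M[K]_2 := lift (P := uq_presentation) std_letterP.
HB.instance Definition _ := GRing.LRMorphism.on uq_std.

Lemma uq_relP (a b : pexpr K uq_letter) :
  uq_rel a b -> eval (gen uq_presentation) a = eval (gen uq_presentation) b.
Proof. exact: (@gen_satisfies K uq_letter uq_presentation). Qed.

Let D1V : uD1 * uD1i = 1. Proof. exact: (uq_relP uq_D1D1i). Qed.
Let VD1 : uD1i * uD1 = 1. Proof. exact: (uq_relP uq_D1iD1). Qed.
Let D2V : uD2 * uD2i = 1. Proof. exact: (uq_relP uq_D2D2i). Qed.
Let VD2 : uD2i * uD2 = 1. Proof. exact: (uq_relP uq_D2iD2). Qed.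
Let D12 : uD1 * uD2 = uD2 * uD1. Proof. exact: (uq_relP uq_D1D2). Qed.
Let D1Ei : uD1 * uE * uD1i = q *: uE. Proof. exact: (uq_relP uq_D1E). Qed.
Let D2Ei : uD2 * uE * uD2i = q^-1 *: uE. Proof. exact: (uq_relP uq_D2E). Qed.
Let D1Fi : uD1 * uF * uD1i = q^-1 *: uF. Proof. exact: (uq_relP uq_D1F). Qed.
Let D2Fi : uD2 * uF * uD2i = q *: uF. Proof. exact: (uq_relP uq_D2F). Qed.
Let EF : uE * uF - uF * uE = (q - q^-1)^-1 *: (uK - uKi).
Proof. exact: (uq_relP uq_EF). Qed.

Let comD (D Di a : uq) (c : K) : Di * D = 1 -> D * a * Di = c *: a ->
  D * a = c *: (a * D).
Proof. by move=> DV H; rewrite scalerAl -H -!mulrA DV mulr1. Qed.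
Let comDi (D Di a : uq) (c : K) : c != 0 -> D * Di = 1 -> Di * D = 1 ->
  D * a * Di = c *: a -> Di * a = c^-1 *: (a * Di).
Proof.
move=> c0 DV VD H; apply: (scalerI c0); rewrite scalerA mulfV // scale1r.
by rewrite scalerAr -H !mulrA VD mul1r.
Qed.

Let qV0 : q^-1 != 0. Proof. by rewrite invr_eq0. Qed.
Let comV (D Di a : uq) : D * Di = 1 -> Di * D = 1 -> D * a = a * D ->
  Di * a = a * Di.
Proof.
move=> DV VD H; rewrite -[LHS]mulr1 -DV mulrA -[Di * a * D]mulrA -H !mulrA.
by rewrite VD mul1r.
Qed.
Let D2iD1 : uD2i * uD1 = uD1 * uD2i. Proof. exact: (comV D2V VD2). Qed.
Let D1iD2 : uD1i * uD2 = uD2 * uD1i. Proof. exact: (comV D1V VD1). Qed.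
Let D1iD2i : uD1i * uD2i = uD2i * uD1i. Proof. exact: (comV D1V VD1). Qed.

Let KF : uK * uF = (q^-1 * q^-1) *: (uF * uK).
Proof.
rewrite /uK -mulrA (comDi q_neq0 D2V VD2 D2Fi) -scalerAr [uD1 * (_ * _)]mulrA.
by rewrite (comD VD1 D1Fi) -scalerAl scalerA -mulrA.
Qed.
Let EKi : uE * uKi = (q * q) *: (uKi * uE).
Proof.
rewrite /uKi -mulrA (comDi q_neq0 D1V VD1 D1Ei) -scalerAr [uD2 * (_ * _)]mulrA.
rewrite (comD VD2 D2Ei) -scalerAl !scalerA -mulrA.
have -> : q * q * (q^-1 * q^-1) = 1.
  by rewrite mulrACA mulfV // mulr1.
by rewrite scale1r -mulrA.
Qed.

Section Tens.
Variables (n : nat) (rho : {lrmorphism uq -> 'M[K]_2}).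
Variable sigma : {lrmorphism uq -> End_tpow K n}.

Let T (a b : uq) : End_tpow K n.+1 := rho a *t sigma b.

Let TM a b c d : T a b * T c d = T (a * c) (b * d).
Proof. by rewrite /T !rmorphM; exact: tensmx_mul. Qed.
Let T1 : T 1 1 = 1.
Proof.
rewrite /T !rmorph1; apply/matrixP=> i j.
case: (mxtens_indexP i) => a b; case: (mxtens_indexP j) => c d.
rewrite tensmxE !mxE -natrM mulnb (can_eq (@mxtens_indexK _ _)).
by rewrite xpair_eqE.
Qed.
Let TDl a b c : T (a + b) c = T a c + T b c.
Proof. by rewrite /T rmorphD; apply/matrixP=> i j; rewrite !mxE mulrDl. Qed.
Let TDr a b c : T c (a + b) = T c a + T c b.
Proof. by rewrite /T rmorphD; apply/matrixP=> i j; rewrite !mxE mulrDr. Qed.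
Let TNl a c : T (- a) c = - T a c.
Proof. by rewrite /T rmorphN; apply/matrixP=> i j; rewrite !mxE mulNr. Qed.
Let TNr a c : T c (- a) = - T c a.
Proof. by rewrite /T rmorphN; apply/matrixP=> i j; rewrite !mxE mulrN. Qed.
Let TZl k a c : T (k *: a) c = k *: T a c.
Proof. by rewrite /T linearZ; apply/matrixP=> i j; rewrite !mxE mulrA. Qed.
Let TZr k a c : T c (k *: a) = k *: T c a.
Proof. by rewrite /T linearZ; apply/matrixP=> i j; rewrite !mxE mulrCA. Qed.

Let KKi : uK * uKi = 1.
Proof. by rewrite /uK /uKi mulrA -[uD1 * uD2i * uD2]mulrA VD2 mulr1. Qed.
Let KKid D Di : D * Di = 1 -> D * uK = uK * D -> D * uK * Di = uK.
Proof. by move=> DV ->; rewrite -mulrA DV mulr1. Qed.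
Let D1K : uD1 * uK = uK * uD1.
Proof. by rewrite /uK -mulrA D2iD1. Qed.
Let D2K : uD2 * uK = uK * uD2.
Proof. by rewrite /uK mulrA -D12 -!mulrA D2V VD2. Qed.
Let D1Ki : uD1 * uKi = uKi * uD1.
Proof. by rewrite /uKi mulrA D12 -!mulrA D1V VD1. Qed.
Let D2Ki : uD2 * uKi = uKi * uD2.
Proof. by rewrite /uKi -!mulrA D1iD2. Qed.
Let KKidi D Di : D * Di = 1 -> D * uKi = uKi * D -> D * uKi * Di = uKi.
Proof. by move=> DV ->; rewrite -mulrA DV mulr1. Qed.

Lemma tens_letterP : satisfies uq_rel (tens_letter rho sigma).
Proof.
have [tE tF] : tens_letter rho sigma LE = T uE 1 + T uK uE /\
               tens_letter rho sigma LF = T uF uKi + T 1 uF.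
  by split; rewrite /tens_letter /= !big_cons big_nil addr0.
have [[t1 t1i] [t2 t2i]] : (tens_letter rho sigma LD1 = T uD1 uD1 /\
     tens_letter rho sigma LD1i = T uD1i uD1i) /\
    (tens_letter rho sigma LD2 = T uD2 uD2 /\
     tens_letter rho sigma LD2i = T uD2i uD2i).
  by rewrite /tens_letter /= !big_cons !big_nil !addr0.
move=> a b [] /=; rewrite ?(tE, tF, t1, t1i, t2, t2i) ?mulrDl ?mulrDr ?mulrDl ?TM.
- by rewrite D12.
- by rewrite D1V T1.
- by rewrite VD1 T1.
- by rewrite D2V T1.
- by rewrite VD2 T1.
- by rewrite mulr1 D1V (KKid D1V D1K) D1Ei TZl TZr scalerDr.
- by rewrite mulr1 D2V (KKid D2V D2K) D2Ei TZl TZr scalerDr.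
- by rewrite mulr1 D1V (KKidi D1V D1Ki) D1Fi TZl TZr scalerDr.
- by rewrite mulr1 D2V (KKidi D2V D2Ki) D2Fi TZl TZr scalerDr.
- rewrite ?(mul1r, mulr1) -/uK -/uKi KF EKi TZl TZr scalerA.
  have -> : q^-1 * q^-1 * (q * q) = 1 by rewrite mulrACA mulVf // mulr1.
  rewrite scale1r.
  set a1 := T (uE * uF) _; set a2 := T uE uF; set a3 := T (uF * uK) _.
  set a4 := T uK (uE * uF); set b1 := T (uF * uE) _; set b4 := T uK (uF * uE).
  have -> : a1 + a2 + (a3 + a4) - (b1 + a3 + (a2 + b4)) = (a1 - b1) + (a4 - b4).
    apply/eqP; rewrite subr_eq; apply/eqP.
    have h (u v w : End_tpow K n.+1) : u - v + (v + w) = u + w.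
      by rewrite addrA subrK.
    by rewrite [RHS]addrACA h [a2 + b4]addrC h addrACA [a2 + a4]addrC.
  rewrite /a1 /b1 /a4 /b4 -TNl -TDl -TNr -TDr EF TZl TZr -scalerDr.
  by rewrite TDl TDr TNl TNr [X in _ *: X]addrC addrA subrK.
Qed.

End Tens.

Definition uq_tens n (rho : {lrmorphism uq -> 'M[K]_2})
    (sigma : {lrmorphism uq -> End_tpow K n}) : uq -> End_tpow K n.+1 :=
  lift (P := uq_presentation) (tens_letterP rho sigma).
HB.instance Definition _ n rho sigma := GRing.LRMorphism.on (@uq_tens n rho sigma).

Definition uq_triv : uq -> End_tpow K 0 :=
  lift (P := uq_presentation) (uq_counitP (End_tpow K 0)).
HB.instance Definition _ := GRing.LRMorphism.on uq_triv.

Fixpoint uq_tpow n : {lrmorphism uq -> End_tpow K n} :=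
  if n is m.+1 then uq_tens uq_std (uq_tpow m) else uq_triv.

Definition uq_act n (u : uq) (v : tpow K n) : tpow K n := uq_tpow n u *m v.

End QuantumGL2.

(* H_i is indexed by the ordinal i < n; s_0 = H_0. *)
Section Hecke.
Variables (K : fieldType) (q : K).

Local Open Scope pexpr_scope.
Inductive hecke_rel (n : nat) : pexpr K 'I_n -> pexpr K 'I_n -> Prop :=
| hecke_quad0 (i : 'I_n) of i = 0%N :> nat :
    hecke_rel (TVar i * TVar i) 1
| hecke_quad (i : 'I_n) of (1 <= i)%N :
    hecke_rel (TVar i * TVar i) (1 + (q^-1 - q) *: TVar i)
| hecke_braid0 (i j : 'I_n) of i = 0%N :> nat & j = 1%N :> nat :
    hecke_rel (TVar i * TVar j * TVar i * TVar j)
              (TVar j * TVar i * TVar j * TVar i)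
| hecke_braid (i j : 'I_n) of (1 <= i)%N & j = i.+1 :> nat :
    hecke_rel (TVar i * TVar j * TVar i) (TVar j * TVar i * TVar j)
| hecke_comm (i j : 'I_n) of (i.+2 <= j)%N :
    hecke_rel (TVar i * TVar j) (TVar j * TVar i).
Local Close Scope pexpr_scope.

Definition hecke_character n (i : 'I_n) : K^o :=
  if (q == 0) || (i == 0%N :> nat) then 1 else q^-1.

Lemma hecke_characterP n : satisfies (@hecke_rel n) (@hecke_character n).
Proof.
have [q0|q0] := eqVneq q 0.
  move=> _ _ [] * /=; rewrite /hecke_character q0 eqxx ?mulr1 //.
  by rewrite invr0 subr0 scale0r addr0.
move=> _ _ [i i0|i i0|i j i0 j1|i j i0 ij|i j ij];
  rewrite /= /hecke_character (negPf q0) /=.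
- by rewrite i0 mulr1.
- rewrite eqn0Ngt i0 /= /GRing.scale /= mulrBl mulfV //.
  by rewrite addrC subrK.
- by rewrite i0 j1 /= !mulr1 !mul1r.
- by rewrite eqn0Ngt i0 ij.
- by rewrite mulrC.
Qed.

Definition hecke_presentation n := Presentation (@hecke_characterP n).
Definition hecke n := presented (hecke_presentation n).

Local Notation x := (vx K).
Local Notation y := (vy K).

(* v.H = hecke_R *m v for v in V (x) V, and v.s_0 = hecke_s0 *m v in V.      *)
Definition hecke_R : 'M[K]_(2 * 2) :=
    (x *t x ~~> q^-1 *: (x *t x))
  + (x *t y ~~> y *t x)
  + (y *t x ~~> (x *t y + (q^-1 - q) *: (y *t x)))
  + (y *t y ~~> q^-1 *: (y *t y)).

Definition hecke_s0 : 'M[K]_2 := (x ~~> y) + (y ~~> x).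

(* v.H_i = hecke_mx n i *m v.  For i >= 2, H_i on V (x) V^(n-1) is           *)
(* id (x) H_(i-1); H_1 on V (x) (V (x) W) is H (x) id_W up to reassociation.  *)
(* The value 1 only occurs outside of the range i < n.                       *)
Fixpoint hecke_mx (n : nat) (i : nat) : End_tpow K n :=
  match n with
  | 0 => 1
  | n'.+1 =>
    match i with
    | 0 => hecke_s0 *t (1 : End_tpow K n')
    | 1 =>
      match n' with
      | 0 => 1
      | m.+1 =>
        castmx (esym (mulnA 2 2 (tdim m)), esym (mulnA 2 2 (tdim m)))
          (hecke_R *t (1 : End_tpow K m))
      end
    | i'.+1 => (1 : 'M[K]_2) *t hecke_mx n' i'
    end
  end.

Hypothesis q_neq0 : q != 0.

Definition slice (m p : nat) (v : 'cV[K]_(m * p)) a : 'cV[K]_p :=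
  \col_k v (mxtens_index (a, k)) 0.

Lemma tens_mulv m p (A : 'M[K]_m) (B : 'M[K]_p) v a :
  slice (A *t B *m v) a = \sum_b A a b *: (B *m slice v b).
Proof.
apply/colP=> k; rewrite summxE !mxE.
rewrite (reindex (@mxtens_index m p)) /=; last first.
  exists (@mxtens_unindex m p) => i _; [exact: mxtens_indexK|exact: mxtens_unindexK].
rewrite (eq_bigr (fun ij => A a ij.1 * (B k ij.2 * slice v ij.1 ij.2 0))); last first.
  by case=> i j _; rewrite tensmxE mxE mulrA.
rewrite -(pair_bigA _ (fun i j => A a i * (B k j * slice v i j 0))) /=.
by apply: eq_bigr => b _; rewrite !mxE mulr_sumr.
Qed.

Lemma sliceP m p (u v : 'cV[K]_(m * p)) : (forall a, slice u a = slice v a) -> u = v.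
Proof.
move=> uv; apply/colP=> i; case: (mxtens_indexP i) => a k.
by have /colP/(_ k) := uv a; rewrite !mxE.
Qed.

Lemma mulv_inj m (A B : 'M[K]_m) : (forall v : 'cV[K]_m, A *m v = B *m v) -> A = B.
Proof.
move=> AB; apply/matrixP=> i j.
have /colP/(_ i) := AB (delta_mx j 0).
by rewrite -!colE !mxE.
Qed.

Lemma tensmxA m n p m' n' p' (A : 'M[K]_(m, m')) (B : 'M[K]_(n, n'))
    (C : 'M[K]_(p, p')) :
  castmx (esym (mulnA m n p), esym (mulnA m' n' p')) (A *t B *t C)
  = A *t (B *t C).
Proof.
apply/matrixP=> i j.
case: (mxtens_indexP i) => a i'; case: (mxtens_indexP i') => b c.
case: (mxtens_indexP j) => a' j'; case: (mxtens_indexP j') => b' c'.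
rewrite castmxE !tensmxE mulrA.
rewrite -(tensmxE A B) -(tensmxE (A *t B) C).
by congr (tensmx _ _ _ _); apply/val_inj; rewrite /= mulnDl mulnA addnA.
Qed.

Lemma ord2P (P : 'I_2 -> Prop) : P 0 -> P 1 -> forall i, P i.
Proof.
move=> P0 P1 [[|[|//]] p].
  by have -> : Ordinal p = 0 by apply/val_inj.
by have -> : Ordinal p = 1 by apply/val_inj.
Qed.

Lemma slice_lin p r (k : K) (s t : 'cV[K]_(p * r)) a :
  slice (k *: s + t) a = k *: slice s a + slice t a.
Proof. by apply/colP=> i; rewrite !mxE. Qed.
Lemma sliceD p r (s t : 'cV[K]_(p * r)) a : slice (s + t) a = slice s a + slice t a.
Proof. by rewrite -[s]scale1r slice_lin !scale1r. Qed.
Lemma sliceZ p r (k : K) (s : 'cV[K]_(p * r)) a : slice (k *: s) a = k *: slice s a.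
Proof. by apply/colP=> i; rewrite !mxE. Qed.

Lemma delta_slice m p (i j : 'I_m) (B : 'M[K]_p) v a :
  slice ((delta_mx i j *t B) *m v) a = (a == i)%:R *: (B *m slice v j).
Proof.
rewrite tens_mulv (bigD1 j) //= big1 ?addr0 => [|b bj]; last first.
  by rewrite mxE (negPf bj) andbF scale0r.
by rewrite mxE eqxx andbT.
Qed.

Let Rt m (a b c d : 'I_2) : 'M[K]_(2 * (2 * tdim m)) :=
  delta_mx a b *t (delta_mx c d *t (1 : 'M[K]_(tdim m))).

Lemma hecke_mx1E m : hecke_mx m.+2 1 =
    q^-1 *: Rt m 0 0 0 0 + Rt m 1 0 0 1 + (Rt m 0 1 1 0 + (q^-1 - q) *: Rt m 1 1 0 0)
    + q^-1 *: Rt m 1 1 1 1 :> 'M[K]_(2 * (2 * tdim m)).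
Proof.
have castD (u v u' v' : nat) (e : (u = u') * (v = v')) (M N : 'M[K]_(u, v)) :
   castmx e (M + N) = castmx e M + castmx e N.
  by case: e => e1 e2; case: u' / e1; case: v' / e2.
have castZ (u v u' v' : nat) (e : (u = u') * (v = v')) k (M : 'M[K]_(u, v)) :
   castmx e (k *: M) = k *: castmx e M.
  by case: e => e1 e2; case: u' / e1; case: v' / e2.
have tD (u v : nat) (M N : 'M[K]_u) (O : 'M[K]_v) : (M + N) *t O = M *t O + N *t O.
  by apply/matrixP=> i j; rewrite !mxE mulrDl.
have tZ (u v : nat) k (M : 'M[K]_u) (O : 'M[K]_v) : (k *: M) *t O = k *: (M *t O).
  by apply/matrixP=> i j; rewrite !mxE mulrA.
have mapt (a b c d : 'I_2) :
    ((delta_mx a 0 : 'cV[K]_2) *t (delta_mx c 0 : 'cV[K]_2))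
    *m ((delta_mx b 0 : 'cV[K]_2) *t (delta_mx d 0 : 'cV[K]_2))^T
    = delta_mx a b *t delta_mx c d.
  by rewrite trmx_tens !trmx_delta tensmx_mul !mul_delta_mx.
rewrite /= /hecke_R /vx /vy mulmxDl -!scalemxAl !mapt !tD !tZ !castD !castZ !tensmxA.
by [].
Qed.

Lemma R_slices m (v : 'cV[K]_(2 * (2 * tdim m))) :
  let w := (hecke_mx m.+2 1 : 'M[K]_(2 * (2 * tdim m))) *m v in
  let V a b := slice (slice v a) b in
  [/\ slice (slice w 0) 0 = q^-1 *: V 0 0,
      slice (slice w 0) 1 = V 1 0,
      slice (slice w 1) 0 = V 0 1 + (q^-1 - q) *: V 1 0
    & slice (slice w 1) 1 = q^-1 *: V 1 1].
Proof.
rewrite hecke_mx1E /= /Rt !mulmxDl -!scalemxAl.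
rewrite !(sliceD, sliceZ, delta_slice) /= !mul1mx.
by rewrite !(scale0r, scale1r, scaler0, add0r, addr0).
Qed.


Let s0_slices m (v : 'cV[K]_(2 * tdim m)) :
  let w := (hecke_mx m.+1 0 : 'M[K]_(2 * tdim m)) *m v in
  slice w 0 = slice v 1 /\ slice w 1 = slice v 0.
Proof.
rewrite /= /hecke_s0 !trmx_delta !mul_delta_mx.
have tD (u w : nat) (M N : 'M[K]_u) (O : 'M[K]_w) : (M + N) *t O = M *t O + N *t O.
  by apply/matrixP=> i j; rewrite !mxE mulrDl.
rewrite tD mulmxDl !(sliceD, delta_slice) /= !mul1mx.
by rewrite !(scale0r, scale1r, add0r, addr0).
Qed.

Let t1 m (M : End_tpow K m) : End_tpow K m.+1 := (1 : 'M[K]_2) *t M.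

Let t1_slice m (M : End_tpow K m) (v : 'cV[K]_(2 * tdim m)) a :
  slice ((t1 M : 'M[K]_(2 * tdim m)) *m v) a = M *m slice v a.
Proof.
rewrite tens_mulv (bigD1 a) //= big1 ?addr0 => [|b ba].
  by rewrite mxE eqxx scale1r.
by rewrite mxE eq_sym (negPf ba) scale0r.
Qed.

Let t1M m (M N : End_tpow K m) : t1 (M * N) = t1 M * t1 N.
Proof.
rewrite -[RHS]/(((1 : 'M[K]_2) *t M) *m ((1 : 'M[K]_2) *t N)).
by rewrite tensmx_mul mul1mx.
Qed.
Let t11 m : t1 1 = 1 :> End_tpow K m.+1.
Proof.
apply/mulv_inj=> v; apply: sliceP => a; rewrite t1_slice.
by rewrite !mul1mx.
Qed.
Let t1L m k (M N : End_tpow K m) : t1 (M + k *: N) = t1 M + k *: t1 N.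
Proof. by apply/matrixP=> i j; rewrite !mxE mulrDr mulrCA. Qed.

Let hecke_mxS n i : hecke_mx n.+1 i.+2 = t1 (hecke_mx n i.+1).
Proof. by []. Qed.

Let R00 m v : slice (slice (hecke_mx m.+2 1 *m v) 0) 0 = q^-1 *: slice (slice v 0) 0.
Proof. by case: (R_slices v). Qed.
Let R01 m v : slice (slice (hecke_mx m.+2 1 *m v) 0) 1 = slice (slice v 1) 0.
Proof. by case: (R_slices v). Qed.
Let R10 m v : slice (slice (hecke_mx m.+2 1 *m v) 1) 0
   = slice (slice v 0) 1 + (q^-1 - q) *: slice (slice v 1) 0.
Proof. by case: (R_slices v). Qed.
Let R11 m v : slice (slice (hecke_mx m.+2 1 *m v) 1) 1 = q^-1 *: slice (slice v 1) 1.
Proof. by case: (R_slices v). Qed.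
Let S0 m v : slice (hecke_mx m.+1 0 *m v) 0 = slice v 1.
Proof. by case: (s0_slices v). Qed.
Let S1 m v : slice (hecke_mx m.+1 0 *m v) 1 = slice v 0.
Proof. by case: (s0_slices v). Qed.
Let H2 m v a : slice (hecke_mx m.+3 2 *m v) a = hecke_mx m.+2 1 *m slice v a.
Proof. exact: (t1_slice (hecke_mx m.+2 1)). Qed.
Let S0' m v : @slice 2 (2 * tdim m) (hecke_mx m.+2 0 *m v) 0 = slice v 1.
Proof. exact: (@S0 m.+1 v). Qed.
Let S1' m v : @slice 2 (2 * tdim m) (hecke_mx m.+2 0 *m v) 1 = slice v 0.
Proof. exact: (@S1 m.+1 v). Qed.
Let H2' m v a : @slice 2 (2 * (2 * tdim m)) (hecke_mx m.+3 2 *m v) a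
  = hecke_mx m.+2 1 *m slice v a.
Proof. exact: (@H2 m v a). Qed.
Let R00' m v : @slice 2 (2 * tdim m)
    (@slice 2 (2 * (2 * tdim m)) (hecke_mx m.+3 1 *m v) 0) 0
  = q^-1 *: slice (slice v 0) 0.
Proof. exact: (@R00 m.+1 v). Qed.
Let R01' m v : @slice 2 (2 * tdim m)
    (@slice 2 (2 * (2 * tdim m)) (hecke_mx m.+3 1 *m v) 0) 1
  = slice (slice v 1) 0.
Proof. exact: (@R01 m.+1 v). Qed.
Let R10' m v : @slice 2 (2 * tdim m)
    (@slice 2 (2 * (2 * tdim m)) (hecke_mx m.+3 1 *m v) 1) 0
  = slice (slice v 0) 1 + (q^-1 - q) *: slice (slice v 1) 0.
Proof. exact: (@R10 m.+1 v). Qed.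
Let R11' m v : @slice 2 (2 * tdim m)
    (@slice 2 (2 * (2 * tdim m)) (hecke_mx m.+3 1 *m v) 1) 1
  = q^-1 *: slice (slice v 1) 1.
Proof. exact: (@R11 m.+1 v). Qed.
Let RE := (S0', S1', R00', R01', R10', R11', R00, R01, R10, R11, S0, S1, sliceD, sliceZ).

Let mulE n (M N : End_tpow K n) : M * N = M *m N.
Proof. by []. Qed.

Lemma hecke_mx_quad0 n : hecke_mx n.+1 0 * hecke_mx n.+1 0 = 1.
Proof.
apply/mulv_inj=> v; rewrite mulE -mulmxA.
rewrite mul1mx; apply: sliceP; apply: ord2P; rewrite !(S0, S1) //.
Qed.

Lemma hecke_mx_quad n i : (1 <= i < n)%N ->
  hecke_mx n i * hecke_mx n i = 1 + (q^-1 - q) *: hecke_mx n i.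
Proof.
elim: n i => [|[|n] IH] [|[|i]] // Hi; last first.
  by rewrite !hecke_mxS -t1M IH // t1L t11.
clear IH; apply/mulv_inj=> v; rewrite mulE -mulmxA mulmxDl mul1mx -scalemxAl.
apply: sliceP; apply: ord2P; apply: sliceP; apply: ord2P; rewrite !RE //; apply/colP=> k; rewrite !mxE; by field.
Qed.

Lemma hecke_mx_braid0 n : 
  hecke_mx n.+2 0 * hecke_mx n.+2 1 * hecke_mx n.+2 0 * hecke_mx n.+2 1 =
  hecke_mx n.+2 1 * hecke_mx n.+2 0 * hecke_mx n.+2 1 * hecke_mx n.+2 0.
Proof.
apply/mulv_inj=> v; rewrite !mulE -!mulmxA.
apply: sliceP; apply: ord2P; apply: sliceP; apply: ord2P; rewrite !RE //; apply/colP=> k; rewrite !mxE; by field.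
Qed.

Lemma hecke_mx_braid n i : (1 <= i)%N -> (i.+1 < n)%N ->
  hecke_mx n i * hecke_mx n i.+1 * hecke_mx n i =
  hecke_mx n i.+1 * hecke_mx n i * hecke_mx n i.+1.
Proof.
elim: n i => [|[|[|n]] IH] [|[|i]] // _ Hi; last first.
  by rewrite !hecke_mxS -!t1M IH.
clear IH; apply/mulv_inj=> v; rewrite !mulE -!mulmxA.
apply: sliceP; apply: ord2P; apply: sliceP; apply: ord2P;
 apply: sliceP; apply: ord2P; do 6?[rewrite ?H2' ?RE]; rewrite //; apply/colP=> k; rewrite !mxE; by field.
Qed.

Lemma hecke_mx_comm n i j : (i.+2 <= j)%N -> (j < n)%N ->
  hecke_mx n i * hecke_mx n j = hecke_mx n j * hecke_mx n i.
Proof.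
elim: n i j => [|n IH] [|[|i]] [|[|j]] // ij jn; last first.
- by rewrite !hecke_mxS -!t1M IH.
- case: n j ij jn IH => [|n] [|j] // ij jn IH.
  have Rt_comm a b c d (N : End_tpow K n) :
      Rt n a b c d *m ((1 : 'M_2) *t ((1 : 'M_2) *t N))
      = ((1 : 'M_2) *t ((1 : 'M_2) *t N)) *m Rt n a b c d.
    by rewrite !tensmx_mul !(mul1mx, mulmx1).
  rewrite !mulE hecke_mx1E.
  rewrite -[hecke_mx n.+2 j.+3]/((1 : 'M_2) *t ((1 : 'M_2) *t hecke_mx n j.+1)).
  by rewrite !(mulmxDl, mulmxDr) -!scalemxAl -!scalemxAr !Rt_comm.
- rewrite -[LHS]/((hecke_s0 *t (1 : End_tpow K n)) *m ((1 : 'M_2) *t hecke_mx n j.+1)).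
  rewrite -[RHS]/(((1 : 'M_2) *t hecke_mx n j.+1) *m (hecke_s0 *t (1 : End_tpow K n))).
  by rewrite !tensmx_mul !(mul1mx, mulmx1).
Qed.

(* The converse algebra, since the action is on the right: v.(gh) = (v.g).h  *)
Definition hecke_letter n (i : 'I_n) : (End_tpow K n)^c := hecke_mx n i.

Lemma hecke_letterP n : satisfies (@hecke_rel n) (@hecke_letter n).
Proof.
case: n => [|n]; first by move=> _ _ [] [].
move=> _ _ [i i0|i i0|i j i0 j1|i j i0 ij|i j ij]; rewrite /= /hecke_letter.
- by rewrite i0; exact: hecke_mx_quad0.
- by apply: hecke_mx_quad; rewrite i0 ltn_ord.
- case: n i j i0 j1 => [i [[|//] ?] //|n] i j i0 j1.
  by rewrite i0 j1 -!mulrA; symmetry; exact: hecke_mx_braid0.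
- have H := hecke_mx_braid i0.
  by rewrite ij -!mulrA; apply: H; rewrite -ij.
- by symmetry; apply: hecke_mx_comm.
Qed.

Definition hecke_tpow n : hecke n -> (End_tpow K n)^c :=
  lift (P := hecke_presentation n) (@hecke_letterP n).
HB.instance Definition _ n := GRing.LRMorphism.on (@hecke_tpow n).

Definition hecke_act n (v : tpow K n) (h : hecke n) : tpow K n :=
  (hecke_tpow h : End_tpow K n) *m v.

End Hecke.

(* s_0 is the letter 0 and U_i the letter i >= 1. *)
Section TemperleyLiebB.
Variables (K : fieldType) (delta : K) (n : nat).

Local Open Scope pexpr_scope.
Inductive tlB_rel : pexpr K 'I_n -> pexpr K 'I_n -> Prop :=
| tlB_loop (i : 'I_n) of (1 <= i)%N :
    tlB_rel (TVar i * TVar i) (delta *: TVar i)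
| tlB_up (i j : 'I_n) of (1 <= i)%N & j = i.+1 :> nat :
    tlB_rel (TVar i * TVar j * TVar i) (TVar i)
| tlB_down (i j : 'I_n) of (1 <= i)%N & j = i.+1 :> nat :
    tlB_rel (TVar j * TVar i * TVar j) (TVar j)
| tlB_comm (i j : 'I_n) of (1 <= i)%N & (i.+2 <= j)%N :
    tlB_rel (TVar i * TVar j) (TVar j * TVar i)
| tlB_s0 (i : 'I_n) of i = 0%N :> nat :
    tlB_rel (TVar i * TVar i) 1
| tlB_blob (i j : 'I_n) of i = 0%N :> nat & j = 1%N :> nat :
    tlB_rel (TVar j * TVar i * TVar j) 0
| tlB_s0_comm (i j : 'I_n) of i = 0%N :> nat & (2 <= j)%N :
    tlB_rel (TVar i * TVar j) (TVar j * TVar i).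
Local Close Scope pexpr_scope.

Definition tlB_character (i : 'I_n) : K^o := (i == 0%N :> nat)%:R.

Lemma tlB_characterP : satisfies tlB_rel tlB_character.
Proof.
move=> _ _ [i i0|i j i0 ij|i j i0 ij|i j i0 ij|i i0|i j i0 j1|i j i0 j2];
  rewrite /= /tlB_character ?i0 ?j1 ?ij ?(eqn0Ngt i) ?i0 /= ?(mulr0, mul0r, mulr1, mul1r) ?scaler0 //.
Qed.

Definition tlB_presentation := Presentation tlB_characterP.
Definition tlB := presented tlB_presentation.

End TemperleyLiebB.

(* The field C(q), with C = R[i] for a model R of the real numbers.          *)
Definition Cq (R : realType) : fieldType := {fraction {poly R[i]}}.
Definition q (R : realType) : Cq R := tofrac 'X.

Lemma q_neq0 R : q R != 0.
Proof. by rewrite tofrac_eq0 polyX_eq0. Qed.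

Lemma qV_neq R : q R - (q R)^-1 != 0.
Proof.
rewrite subr_eq0; apply/eqP=> qV.
have : q R * q R = 1 by rewrite {2}qV mulfV // q_neq0.
rewrite /q -tofracM -tofrac1 => /eqP; rewrite tofrac_eq => /eqP.
move/(congr1 (fun p : {poly _} => size p)).
by rewrite -expr2 size_polyXn size_poly1.
Qed.

Section Images.
Variables (R : realType) (n : nat).

Definition Uiota_image : set (End_tpow (Cq R) n) :=
  [set uq_tpow (q_neq0 R) (qV_neq R) n u | u in @Uiota (Cq R) (q R)].

Definition hecke_image : set (End_tpow (Cq R) n) :=
  [set hecke_tpow (q_neq0 R) h | h in [set: hecke (q R) n]].

(* End_{U^iota}(V^(x)n) *)
Definition End_Uiota : set (End_tpow (Cq R) n) :=
  [set f | forall (u : uq (q R)) (v : tpow (Cq R) n), Uiota u ->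
     f *m uq_act (q_neq0 R) (qV_neq R) u v
     = uq_act (q_neq0 R) (qV_neq R) u (f *m v)].

End Images.
Arguments Uiota_image R n : clear implicits.
Arguments hecke_image R n : clear implicits.
Arguments End_Uiota R n : clear implicits.

(* Main.v *)
(* On V^(x)n the element C acts by a scalar and B by s_0 (x) K^-1 + 1 (x) B, which is
   diagonalized by pure tensors indexed by words in {+, -}, read as paths in Z starting at
   0: a step from m to m+1 or m-1 contributes the factor x + q^m y or x - q^-m y, and a
   path ending at m has eigenvalue [m] = (q^m - q^-m) / (q - q^-1). In this basis s_0 acts
   by the sign of the first step and U_i = H_i - q^-1 mixes a path with the one where the
   steps i and i+1 are exchanged, with nonzero coefficients when they differ. The
   commutant of B is spanned by the matrix units E_(P,Q) with P and Q of the same endpoint.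

   That TL(B_n) maps isomorphically onto this commutant is proved by induction on n. Let A
   be the image of TL(B_n) in TL(B_(n+1)) and U the last generator. Since U A U is
   contained in A' U, with A' the image of TL(B_(n-1)), one gets
   TL(B_(n+1)) = < 1, s_0 > + A U A. Writing A by its matrix units, which exist
   by induction, and moving those of A' through U, the space A U A is spanned by elements
   S_(P,Q), one for each pair of nonconstant paths with the same endpoint, which act as
   nonzero multiples of E_(P,Q). As 1 and s_0 are independent on the two constant paths,
   this spanning family is sent to a basis of the commutant of B.

   Finally an operator commuting with all E_(P,Q) is a function of the endpoint, hence a
   polynomial in B because the eigenvalues [m] are distinct. *)
Require Import Defs.
From HB Require Import structures.
From mathcomp Require Import all_boot all_algebra.
From mathcomp Require Import boolp classical_sets reals.
From mathcomp.real_closed Require complex.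
From mathcomp.real_closed Require Import mxtens.
From mathcomp Require Import ring.

Set Implicit Arguments.
Unset Strict Implicit.
Unset Printing Implicit Defensive.

Import GRing.Theory complex.ComplexField.
Local Open Scope classical_set_scope.
Local Open Scope ring_scope.

(** * The tower of type B Temperley-Lieb algebras *)

Section TemperleyLiebAlgebra.
Variables (K : fieldType) (delta : K).
Local Notation TL n := (tlB delta n).

(** Structural induction on a representing expression. Closure under [k *: u + v] covers zero,
    opposites, sums and scalings at once, because zero is $-1\cdot 1+1$. *)
Lemma presented_ind (G : Type) (P : presentation K G) (S : presented P -> Prop) :
  (forall g, S (gen P g)) -> S 1 -> (forall k u v, S u -> S v -> S (k *: u + v)) ->
  (forall u v, S u -> S v -> S (u * v)) -> forall u, S u.
Proof.
move=> Sg S1 Sl SM u; elim/quotW: u => t; rewrite -eval_gen.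
have S0 : S 0 by rewrite -(subrr 1) addrC -scaleN1r; apply: Sl.
elim: t => //= [a Sa|a Sa b Sb|a Sa b Sb|k a Sa].
- by rewrite -scaleN1r -[_ *: _]addr0; apply: Sl.
- by rewrite -[eval _ a]scale1r; apply: Sl.
- exact: SM.
- by rewrite -[_ *: _]addr0; apply: Sl.
Qed.

(** Indexing by [nat], with the junk value 0 out of range, lets neighbouring generators and
    different levels of the tower be compared without casts of ordinals. *)
Definition tlgen n (i : nat) : TL n :=
  if insub i is Some j then gen (tlB_presentation delta n) j else 0.

Lemma tlgenE n (i : 'I_n) : tlgen n i = gen (tlB_presentation delta n) i.
Proof. by rewrite /tlgen valK. Qed.

Lemma tlB_ind n (S : TL n -> Prop) :
  S 1 -> (forall i, (i < n)%N -> S (tlgen n i)) ->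
  (forall k u v, S u -> S v -> S (k *: u + v)) ->
  (forall u v, S u -> S v -> S (u * v)) -> forall u, S u.
Proof.
move=> S1 Sg Sl SM; apply: presented_ind => // i.
by rewrite -tlgenE; apply: Sg.
Qed.

Let rel n a b : @tlB_rel K delta n a b ->
  eval (gen (tlB_presentation delta n)) a = eval (gen (tlB_presentation delta n)) b.
Proof. exact: (@gen_satisfies _ _ (tlB_presentation delta n)). Qed.

Lemma tlgen_loop n i : (1 <= i < n)%N -> tlgen n i * tlgen n i = delta *: tlgen n i.
Proof.
case/andP=> i0 hi; rewrite -[i]/(val (Ordinal hi)) !tlgenE.
exact: (rel (@tlB_loop K delta n (Ordinal hi) i0)).
Qed.
Lemma tlgen_up n i : (1 <= i)%N -> (i.+1 < n)%N ->
  tlgen n i * tlgen n i.+1 * tlgen n i = tlgen n i.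
Proof.
move=> i0 hj; have hi := ltnW hj.
rewrite -[i.+1]/(val (Ordinal hj)) -[i]/(val (Ordinal hi)) !tlgenE.
exact: (rel (@tlB_up K delta n (Ordinal hi) (Ordinal hj) i0 erefl)).
Qed.
Lemma tlgen_down n i : (1 <= i)%N -> (i.+1 < n)%N ->
  tlgen n i.+1 * tlgen n i * tlgen n i.+1 = tlgen n i.+1.
Proof.
move=> i0 hj; have hi := ltnW hj.
rewrite -[i.+1]/(val (Ordinal hj)) -[i]/(val (Ordinal hi)) !tlgenE.
exact: (rel (@tlB_down K delta n (Ordinal hi) (Ordinal hj) i0 erefl)).
Qed.
Lemma tlgen_comm n i j : (i.+2 <= j)%N -> (j < n)%N ->
  tlgen n i * tlgen n j = tlgen n j * tlgen n i.
Proof.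
move=> ij hj; have hi := ltn_trans (ltnW ij) hj.
rewrite -[j]/(val (Ordinal hj)) -[i]/(val (Ordinal hi)) !tlgenE.
case: (posnP i) => i0.
  apply: (rel (@tlB_s0_comm K delta n (Ordinal hi) (Ordinal hj) i0 _)).
  by move: ij; rewrite i0.
exact: (rel (@tlB_comm K delta n (Ordinal hi) (Ordinal hj) i0 ij)).
Qed.
Lemma tlgen_s0 n : (0 < n)%N -> tlgen n 0 * tlgen n 0 = 1.
Proof.
move=> hi; rewrite -[0%N]/(val (Ordinal hi)) !tlgenE.
exact: (rel (@tlB_s0 K delta n (Ordinal hi) erefl)).
Qed.
Lemma tlgen_blob n : (1 < n)%N -> tlgen n 1 * tlgen n 0 * tlgen n 1 = 0.
Proof.
move=> hj; have hi := ltnW hj.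
rewrite -[1%N]/(val (Ordinal hj)) -[0%N]/(val (Ordinal hi)) !tlgenE.
exact: (rel (@tlB_blob K delta n (Ordinal hi) (Ordinal hj) erefl erefl)).
Qed.

Definition tlemb_letter n (i : 'I_n) : TL n.+1 := tlgen n.+1 i.

Lemma tlemb_letterP n : satisfies (@tlB_rel K delta n) (@tlemb_letter n).
Proof.
move=> _ _ [i i0|i j i0 ij|i j i0 ij|i j i0 ij|i i0|i j i0 j1|i j i0 j2] /=;
  rewrite /tlemb_letter.
- by apply: tlgen_loop; rewrite i0 ltnW ?ltnS ?ltn_ord.
- by rewrite ij; apply: tlgen_up => //; rewrite -ij ltnW ?ltnS.
- by rewrite ij; apply: tlgen_down => //; rewrite -ij ltnW ?ltnS.
- by apply: tlgen_comm => //; rewrite ltnW ?ltnS.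
- by rewrite i0 tlgen_s0.
- by rewrite i0 j1 tlgen_blob // ltnS -j1 ltnW.
- by apply: tlgen_comm; rewrite ?i0 // ltnW ?ltnS.
Qed.

Definition tlemb n : TL n -> TL n.+1 :=
  Defs.lift (P := tlB_presentation delta n) (@tlemb_letterP n).
HB.instance Definition _ n := GRing.LRMorphism.on (@tlemb n).

Lemma tlemb_gen n i : (i < n)%N -> tlemb (tlgen n i) = tlgen n.+1 i.
Proof. by move=> hi; rewrite -[i]/(val (Ordinal hi)) tlgenE /tlemb lift_gen. Qed.

(** Every generator of [TL n] has index at most [n.-1], hence is at distance at least 2 from
    [n.+1]. *)
Lemma tlemb_comm n (u : TL n) :
  tlgen n.+2 n.+1 * tlemb (tlemb u) = tlemb (tlemb u) * tlgen n.+2 n.+1.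
Proof.
elim/tlB_ind: u => [|i hi|k u v IHu IHv|u v IHu IHv].
- by rewrite !rmorph1 mulr1 mul1r.
- have hi' : (i < n.+1)%N := ltnW hi.
  by rewrite !tlemb_gen //; apply/esym/tlgen_comm.
- by rewrite !linearP mulrDr mulrDl -scalerAr -scalerAl IHu IHv.
- by rewrite !rmorphM mulrA IHu -mulrA IHv mulrA.
Qed.

(* By construction only a bimodule over the image of [tlemb]; it is a two-sided
   ideal because of [tlB_expect]. *)
Inductive tlideal n : TL n.+1 -> Prop :=
| tlideal_mul a b : tlideal (tlemb a * tlgen n.+1 n * tlemb b)
| tlideal_lin k u v of tlideal u & tlideal v : tlideal (k *: u + v).

Lemma tlideal_0 n : @tlideal n 0.
Proof.
have H := @tlideal_mul n 0 0; rewrite rmorph0 !mul0r in H.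
exact: H.
Qed.

Lemma tlideal_Ml n a (u : TL n.+1) : tlideal u -> tlideal (tlemb a * u).
Proof.
elim=> [b c|k {}u v _ Iu _ Iv].
  by rewrite !mulrA -rmorphM; apply: tlideal_mul.
by rewrite mulrDr -scalerAr; apply: tlideal_lin.
Qed.

Lemma tlideal_Mr n a (u : TL n.+1) : tlideal u -> tlideal (u * tlemb a).
Proof.
elim=> [b c|k {}u v _ Iu _ Iv].
  by rewrite -!mulrA -rmorphM mulrA; apply: tlideal_mul.
by rewrite mulrDl -scalerAl; apply: tlideal_lin.
Qed.

(** Downward induction from [i = n]: the relation $U_i=U_iU_{i+1}U_i$ puts $U_i$ in the ideal as
    soon as $U_{i+1}$ is there. *)
Lemma tlideal_gen n i : (1 <= i)%N -> (i <= n)%N -> tlideal (tlgen n.+1 i).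
Proof.
move=> i0; move dE : (n - i)%N => d; elim: d i i0 dE => [|d IH] i i0 dE i_n.
  have -> : i = n by apply/eqP; rewrite eqn_leq i_n /= -subn_eq0 dE.
  by have := @tlideal_mul n 1 1; rewrite !rmorph1 mul1r mulr1.
have lt_in : (i < n)%N by rewrite -subn_gt0 dE.
rewrite -tlgen_up // -(tlemb_gen lt_in); apply/tlideal_Mr/tlideal_Ml/IH => //.
by rewrite subnS dE.
Qed.

Section Step.
Variables (n : nat).
Hypothesis expect : forall a : TL n.+1, exists c : TL n,
  tlgen n.+2 n.+1 * tlemb a * tlgen n.+2 n.+1 = tlemb (tlemb c) * tlgen n.+2 n.+1.

Lemma tlideal_last_mul (u : TL n.+2) : tlideal u -> tlideal (tlgen n.+2 n.+1 * u).
Proof.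
elim=> [a b|k {}u v _ Iu _ Iv]; last by rewrite mulrDr -scalerAr; apply: tlideal_lin.
by have [c cE] := expect a; rewrite !mulrA cE; apply: tlideal_mul.
Qed.

(** The elements of this form contain 1 and are stable under left multiplication by each generator.
    Only the last generator lies outside the image of [tlemb], and [expect] handles it. *)
Lemma tlB_decomp_step (x : TL n.+2) :
  exists k l u, tlideal u /\ x = k%:A + l *: tlgen n.+2 0 + u.
Proof.
pose D x := exists k l u, @tlideal n.+1 u /\ x = k%:A + l *: tlgen n.+2 0 + u.
have Dl k u v : D u -> D v -> D (k *: u + v).
  move=> [k1 [l1 [u1 [I1 ->]]]] [k2 [l2 [u2 [I2 ->]]]].
  exists (k * k1 + k2), (k * l1 + l2), (k *: u1 + u2); split; first exact: tlideal_lin.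
  rewrite !scalerDr !scalerDl !scalerA addrACA; congr (_ + _).
  by rewrite addrACA.
have DI u : tlideal u -> D u.
  by move=> Iu; exists 0, 0, u; rewrite !scale0r !add0r.
have D1 : D 1 by exists 1, 0, 0; rewrite scale1r scale0r !addr0; split=> //; apply: tlideal_0.
have Ds : D (tlgen n.+2 0).
  by exists 0, 1, 0; rewrite scale1r scale0r add0r addr0; split=> //; apply: tlideal_0.
have Dg i u : (i < n.+2)%N -> D u -> D (tlgen n.+2 i * u).
  move=> hi [k [l [v [Iv ->]]]].
  rewrite -[_ + l *: _ + v]addrA mulrDr -scalerAr mulr1.
  have dD a b : D a -> D b -> D (a + b).
    by move=> Da Db; rewrite -[a]scale1r; apply: Dl.
  have D0 : D 0 by apply/DI/tlideal_0.
  have dZ c a : D a -> D (c *: a) by move=> Da; rewrite -[_ *: _]addr0; apply: Dl.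
  have Dgi : D (tlgen n.+2 i).
    by case: i hi => [|i] hi //; apply/DI/tlideal_gen.
  apply: (dD); first exact: dZ.
  rewrite mulrDr -scalerAr; apply: dD.
    apply: dZ; case: i hi {Dgi} => [|i] hi; first by rewrite tlgen_s0.
    apply: DI; rewrite -[tlgen _ 0](@tlemb_gen n.+1) //.
    exact/tlideal_Mr/tlideal_gen.
  apply: DI; have [->|ne] := eqVneq i n.+1; first exact: tlideal_last_mul.
  have lt_i : (i < n.+1)%N by rewrite ltn_neqAle ne.
  by rewrite -(tlemb_gen lt_i); apply: tlideal_Ml.
(* Stability under left multiplication by [x] is what passes through an induction on [x]; it is then
   applied to [y = 1]. *)
suff DM y : D y -> D (x * y) by have := DM 1 D1; rewrite mulr1.
elim/tlB_ind: x y => [|i hi|k u v IHu IHv|u v IHu IHv] y Dy.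
- by rewrite mul1r.
- exact: Dg.
- by rewrite mulrDl -scalerAl; apply: Dl; [apply: IHu | apply: IHv].
- by rewrite -mulrA; apply/IHu/IHv.
Qed.

End Step.

Lemma tlB1_decomp (x : TL 1) : exists k l, x = k%:A + l *: tlgen 1 0.
Proof.
elim/tlB_ind: x => [|i hi|k u v [a [b ->]] [c [d ->]]|u v [a [b ->]] [c [d ->]]].
- by exists 1, 0; rewrite scale1r scale0r addr0.
- by case: i hi => // _; exists 0, 1; rewrite scale1r scale0r add0r.
- exists (k * a + c), (k * b + d).
  by rewrite !scalerDr !scalerDl !scalerA addrACA.
exists (a * c + b * d), (a * d + b * c).
rewrite !mulrDl !mulrDr -!scalerAl -!scalerAr !mul1r !mulr1 !scalerA tlgen_s0 //.
by rewrite !scalerDl [X in _ + X = _]addrC addrACA.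
Qed.

(** Runs in tandem with [tlB_decomp_step]: the statement at one level gives the decomposition one
    level up, to which the next case reduces. There $1$ and $s_0$ come from two levels below the
    last generator $U$ and commute with it, while $b\,U'c$ is treated by $UU'U=U$. For [n = 0] the
    blob relation removes the $s_0$ term. *)
Lemma tlB_expect n (a : TL n.+1) : exists c : TL n,
  tlgen n.+2 n.+1 * tlemb a * tlgen n.+2 n.+1 = tlemb (tlemb c) * tlgen n.+2 n.+1.
Proof.
elim: n a => [|n IH] a.
  have [k [l ->]] := tlB1_decomp a; exists (k * delta)%:A.
  rewrite linearD !linearZ !rmorph1 /= tlemb_gen // mulrDr mulrDl.
  rewrite -!scalerAr -!scalerAl tlgen_blob // scaler0 addr0 mulr1 mul1r.
  by rewrite tlgen_loop // scalerA.
set U := tlgen n.+3 n.+2.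
have UU : U * U = delta *: U by rewrite tlgen_loop //=.
pose X (a : TL n.+2) := exists c : TL n.+1, U * tlemb a * U = tlemb (tlemb c) * U.
have Xl k u v : X u -> X v -> X (k *: u + v).
  move=> [c cE] [d dE]; exists (k *: c + d).
  by rewrite !linearP mulrDr !mulrDl -scalerAr -!scalerAl cE dE.
have Xe (b : TL n.+1) : X (tlemb b).
  exists (delta *: b).
  by rewrite tlemb_comm -mulrA UU !linearZ /= -scalerAr -scalerAl.
have [k [l [u [Iu ->]]]] := tlB_decomp_step IH a.
rewrite -/(X _) -addrA; apply: (Xl).
  by have := Xe 1; rewrite rmorph1.
apply: (Xl); first by rewrite -[tlgen _ 0](@tlemb_gen n.+1).
elim: Iu => [b c|k' v w _ Xv _ Xw]; last exact: Xl.
exists (b * c); rewrite !rmorphM /= tlemb_gen // !mulrA tlemb_comm.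
rewrite -!mulrA -(tlemb_comm c) -/U; congr (_ * _).
by rewrite !mulrA tlgen_down.
Qed.

Lemma tlB_decomp n (x : TL n.+2) :
  exists k l u, tlideal u /\ x = k%:A + l *: tlgen n.+2 0 + u.
Proof. exact/tlB_decomp_step/tlB_expect. Qed.

End TemperleyLiebAlgebra.

(** * The path basis *)

Section PathBasis.
Variables (K : fieldType) (q : K).
Hypotheses (q0 : q != 0) (q_nroot : forall n, q ^+ n.+1 != 1).
Hypothesis two_neq0 : 2%:R != 0 :> K.

(** The points that a path can visit; the restriction to integer powers of [q] is what makes [wd t]
    nonzero. *)
Definition qpow (t : K) := exists m : int, t = q ^ m.

Lemma exprz_eq1 (m : int) : (q ^ m == 1) = (m == 0).
Proof.
apply/eqP/eqP=> [|->]; last by rewrite expr0z.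
case: m => [[|n]|n] // /eqP; first by rewrite -exprnP (negPf (q_nroot n)).
by rewrite NegzE -exprnN invr_eq1 (negPf (q_nroot n)).
Qed.

(** Squaring $q^m=-1$ gives $q^{2m}=1$, so $m=0$ and $1=-1$, against [two_neq0]. *)
Lemma exprz_neqN1 (m : int) : q ^ m != -1.
Proof.
apply/eqP=> qm; have /eqP : q ^ (m * 2) = 1.
  by rewrite -exprz_exp qm -exprnP sqrrN expr1n.
rewrite exprz_eq1 mulf_eq0 orbF => /eqP m0; move: qm.
rewrite m0 expr0z => /eqP; rewrite -subr_eq0 opprK -mulr2n.
by rewrite (negPf two_neq0).
Qed.

Lemma qpow_1 : qpow 1. Proof. by exists 0; rewrite expr0z. Qed.

Lemma qpow_neq0 t : qpow t -> t != 0.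
Proof. by move=> [m ->]; rewrite expfz_neq0. Qed.

(** Up to sign, the determinant of [pvec t true] and [pvec t false]: its nonvanishing makes them a
    basis of $V$. *)
Definition wd (t : K) := t + t^-1.

Lemma wd_neq0 t : qpow t -> wd t != 0.
Proof.
move=> ht; have t0 := qpow_neq0 ht; case: ht => m mE.
apply: contra (exprz_neqN1 (m * 2)) => /eqP w0.
have : t * wd t = 0 by rewrite w0 mulr0.
rewrite /wd mulrDr mulfV // => /eqP; rewrite addr_eq0 => /eqP <-.
by rewrite -exprz_exp -mE -exprnP expr2.
Qed.

(* [t] stands for q^m, where the quantum integer [m] is an eigenvalue of B; a step of
   the path changes m by 1 or by -1. *)
Definition step (t : K) (b : bool) := if b then t * q else t / q.

Lemma qpow_step t b : qpow t -> qpow (step t b).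
Proof.
move=> [m ->]; rewrite /step; case: b; [exists (m + 1) | exists (m - 1)].
  by rewrite expfzDr // expr1z.
by rewrite expfzDr // exprN1.
Qed.

Local Notation x := (vx K).
Local Notation y := (vy K).

(* The eigenvectors, for the eigenvalues [m+1] and [m-1], of [m] K^-1 + B on V. *)
Definition pvec (t : K) (b : bool) : 'cV[K]_2 :=
  x + (if b then t else - t^-1) *: y.
Definition pdual (t : K) (b : bool) : 'rV[K]_2 :=
  (wd t)^-1 *: ((if b then t^-1 else t) *: x^T + (if b then 1 else -1) *: y^T).

(* The casts use that [1 * 1] is convertible to [1]. *)
Definition ctens m (a : 'cV[K]_2) (w : 'cV[K]_m) : 'cV[K]_(2 * m) :=
  a *t w : 'M_(2 * m, 1 * 1).
Definition rtens m (a : 'rV[K]_2) (w : 'rV[K]_m) : 'rV[K]_(2 * m) :=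
  a *t w : 'M_(1 * 1, 2 * m).

Lemma rtens_ctens m a (w : 'rV[K]_m) c (z : 'cV[K]_m) :
  rtens a w *m ctens c z = ((a *m c) 0 0 * (w *m z) 0 0)%:M.
Proof.
have -> : rtens a w *m ctens c z = (a *m c) *t (w *m z) :> 'M_(1 * 1).
  exact: tensmx_mul.
by apply/matrixP=> i j; rewrite !ord1 !mxE !ord1 mulr1n.
Qed.

Lemma ctens_rtens m a (w : 'rV[K]_m) c (z : 'cV[K]_m) :
  ctens c z *m rtens a w = (c *m a) *t (z *m w).
Proof. exact: (@tensmx_mul K 2 1 m 1 2 m). Qed.

Lemma tensmx_ctens m (A : 'M_2) (B : 'M_m) a (w : 'cV[K]_m) :
  (A *t B) *m ctens a w = ctens (A *m a) (B *m w).
Proof. exact: (@tensmx_mul K 2 2 m m 1 1). Qed.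

Lemma slice_ctens m a (w : 'cV[K]_m) i : slice (ctens a w) i = a i 0 *: w.
Proof.
apply/colP=> k; rewrite !mxE; congr (a _ _ * w _ _); rewrite ?ord1 //=.
  exact: (congr1 fst (mxtens_indexK (i, k))).
exact: (congr1 snd (mxtens_indexK (i, k))).
Qed.

(** The starting point is a parameter because the tail of a path starts elsewhere. The defaults of
    [head] and [behead] only concern lists shorter than [n]. *)
Fixpoint pathv n (t : K) (p : seq bool) : tpow K n :=
  if n is n'.+1 then
    ctens (pvec t (head true p)) (pathv n' (step t (head true p)) (behead p))
  else const_mx 1.

Fixpoint pathd n (t : K) (p : seq bool) : 'rV[K]_(tdim n) :=
  if n is n'.+1 then
    rtens (pdual t (head true p)) (pathd n' (step t (head true p)) (behead p))
  else const_mx 1.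

Lemma pvecE t b : (pvec t b 0 0 = 1) * (pvec t b 1 0 = if b then t else - t^-1).
Proof. by rewrite !mxE /= mulr0 mulr1 addr0 add0r. Qed.

Lemma pdual_pvec t b c : qpow t -> pdual t b *m pvec t c = (b == c)%:R%:M.
Proof.
move=> ht; have t0 := qpow_neq0 ht; have w0 := wd_neq0 ht.
apply/matrixP=> i j; rewrite !ord1 !mxE !big_ord_recl big_ord0 !mxE /=.
move: w0; rewrite /wd.
(* Clears the inner fraction, so that the hypothesis becomes $t^2+1\neq0$, the side condition left
   by [field]. *)
have -> : t + t^-1 = (t ^+ 2 + 1) / t by field.
rewrite mulf_eq0 negb_or => /andP[w0 _].
by case: b c => [] [] /=; field; rewrite ?w0 ?t0.
Qed.

Lemma sum_pvec_pdual t : qpow t ->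
  pvec t true *m pdual t true + pvec t false *m pdual t false = 1%:M.
Proof.
move=> ht; have t0 := qpow_neq0 ht; have w0 := wd_neq0 ht.
move: w0; rewrite /wd.
have wE : t + t^-1 = (t ^+ 2 + 1) / t by field.
rewrite wE mulf_eq0 negb_or => /andP[w0 _].
apply/matrixP; apply: ord2P; apply: ord2P;
  by rewrite !mxE !big_ord_recl !big_ord0 !mxE /= /wd wE; field; rewrite ?w0 ?t0.
Qed.

Lemma tensmx11 (m n : nat) : (1%:M : 'M[K]_m) *t (1%:M : 'M[K]_n) = 1%:M.
Proof.
apply/matrixP=> i j.
case: (mxtens_indexP i) => a b; case: (mxtens_indexP j) => c d.
rewrite tensmxE !mxE -natrM mulnb (can_eq (@mxtens_indexK _ _)).
by rewrite xpair_eqE.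
Qed.

Lemma tensmx_sumr (I : finType) m n (A : 'M[K]_m) (B : I -> 'M[K]_n) :
  A *t (\sum_i B i) = \sum_i A *t B i.
Proof.
apply/matrixP=> i j; rewrite summxE mxE summxE mulr_sumr.
by apply: eq_bigr => k _; rewrite mxE.
Qed.

Lemma pathd_pathv n t p r : qpow t -> size p = n -> size r = n ->
  pathd n t p *m pathv n t r = (p == r)%:R%:M.
Proof.
elim: n t p r => [|n IH] t [|b p] [|c r] //= ht.
  by move=> _ _; apply/matrixP=> i j; rewrite !ord1 !mxE big_ord1 !mxE mul1r.
move=> [sp] [sr]; rewrite rtens_ctens pdual_pvec // eqseq_cons.
have [<-|_] /= := eqVneq b c; last by rewrite !mxE mul0r.
rewrite IH //; last exact: qpow_step.
by rewrite !mxE mul1r.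
Qed.

Lemma big_tuple_cons (V : nmodType) n (F : seq bool -> V) :
  \sum_(p : n.+1.-tuple bool) F p =
  \sum_(p : n.-tuple bool) F (true :: p) + \sum_(p : n.-tuple bool) F (false :: p).
Proof.
rewrite (reindex (fun bp : bool * n.-tuple bool => [tuple of bp.1 :: bp.2])) /=; last first.
  exists (fun p : n.+1.-tuple bool => (thead p, [tuple of behead p])) => [[b p] _|p _].
    by congr (_, _) => //; apply/val_inj.
  by rewrite [RHS](tuple_eta p).
rewrite -(pair_bigA _ (fun b (p : n.-tuple bool) => F (b :: p))) /=.
by rewrite big_bool.
Qed.

(** For either first step the sum over the tails is the identity by induction, although the tails
    start at different points; what remains is [sum_pvec_pdual] in the first factor. *)
Lemma sum_pathv_pathd n t : qpow t ->
  \sum_(p : n.-tuple bool) pathv n t p *m pathd n t p = 1%:M.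
Proof.
elim: n t => [|n IH] t ht.
  rewrite (big_pred1 [tuple]) => [|p]; last exact/esym/eqP/tuple0.
  by apply/matrixP=> i j; rewrite !ord1 !mxE big_ord1 !mxE mul1r.
rewrite (@big_tuple_cons _ _ (fun p => pathv n.+1 t p *m pathd n.+1 t p)) /=.
have tensr (b : bool) : \sum_(p : n.-tuple bool)
    ctens (pvec t b) (pathv n (step t b) p) *m
    rtens (pdual t b) (pathd n (step t b) p) =
    (pvec t b *m pdual t b) *t (1%:M : 'M_(tdim n)).
  rewrite -(IH (step t b)); last exact: qpow_step.
  under eq_bigr do rewrite ctens_rtens.
  by rewrite tensmx_sumr.
rewrite !tensr -(tensmx11 2) -(sum_pvec_pdual ht).
by apply/matrixP=> i j; rewrite !mxE mulrDl.
Qed.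


(** * The action on the path basis *)

Lemma ctensZl m c a (w : 'cV[K]_m) : ctens (c *: a) w = c *: ctens a w.
Proof. by apply/colP=> i; rewrite !mxE mulrA. Qed.
Lemma ctensZr m c a (w : 'cV[K]_m) : ctens a (c *: w) = c *: ctens a w.
Proof. by apply/colP=> i; rewrite !mxE mulrCA. Qed.
Lemma ctensDl m a b (w : 'cV[K]_m) : ctens (a + b) w = ctens a w + ctens b w.
Proof. by apply/colP=> i; rewrite !mxE mulrDl. Qed.
Lemma ctensDr m a (w z : 'cV[K]_m) : ctens a (w + z) = ctens a w + ctens a z.
Proof. by apply/colP=> i; rewrite !mxE mulrDr. Qed.
Lemma ctensBr m a (w z : 'cV[K]_m) : ctens a (w - z) = ctens a w - ctens a z.
Proof. by apply/colP=> i; rewrite !mxE mulrBr. Qed.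

Lemma qV_neq0 : q - q^-1 != 0.
Proof.
have -> : q - q^-1 = (q ^+ 2 - 1) / q by field.
by rewrite mulf_neq0 ?invr_eq0 // subr_eq0 q_nroot.
Qed.

Definition kinv2 : 'M[K]_2 := (x ~~> q^-1 *: x) + (y ~~> q *: y).

Fixpoint kinv_op n : End_tpow K n :=
  if n is n'.+1 then kinv2 *t kinv_op n' else 1.
(** The recursion follows $\Delta(B)=B\otimes K^{-1}+1\otimes B$, with $B$ acting on $V$ by
    [hecke_s0] and $K^{-1}$ by [kinv2]. *)
Fixpoint B_op n : End_tpow K n :=
  if n is n'.+1 then @hecke_s0 K *t kinv_op n' + 1%:M *t B_op n' else 0.

Definition qint (t : K) := (t - t^-1) / (q - q^-1).

Lemma pvec_step t b : qpow t ->
  @hecke_s0 K *m pvec t b + qint t *: (kinv2 *m pvec t b)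
  = qint (step t b) *: pvec t b.
Proof.
move=> ht; have t0 := qpow_neq0 ht; have qq := q_nroot 1.
apply/colP; rewrite /qint.
have -> : q - q^-1 = (q ^+ 2 - 1) / q by field.
apply: ord2P; rewrite !mxE !big_ord_recl !big_ord0 !mxE /= !big_ord_recl !big_ord0 !mxE /=;
  case: b => /=; field; rewrite ?t0 ?q0 ?subr_eq0 ?qq //.
Qed.

(** On $V\otimes W$ the operator is $(s_0+[m]K^{-1})\otimes K^{-1}+1\otimes B$ for $t=q^m$. The
    first factor of the path vector turns the bracket into the scalar $[m\pm1]$, which leaves the
    same kind of operator on $W$ with the next point as parameter. *)
Lemma B_op_pathv_gen n t p : qpow t -> size p = n ->
  (B_op n + qint t *: kinv_op n) *m pathv n t p = qint (foldl step t p) *: pathv n t p.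
Proof.
elim: n t p => [|n IH] t [|b p] //= ht sp; first by rewrite add0r -scalemxAl mul1mx.
case: sp => sp; rewrite !mulmxDl -scalemxAl !tensmx_ctens mul1mx addrAC.
rewrite -ctensZl -ctensDl pvec_step // ctensZl -ctensZr -ctensDr -ctensZr.
rewrite -(IH _ _ _ sp); last exact: qpow_step.
by rewrite mulmxDl scalemxAl addrC.
Qed.

(** At the starting point 1 the coefficient of [kinv_op] is $[0]=0$. *)
Lemma B_op_pathv n p : size p = n ->
  B_op n *m pathv n 1 p = qint (foldl step 1 p) *: pathv n 1 p.
Proof.
move=> sp; rewrite -B_op_pathv_gen //; last exact: qpow_1.
by rewrite /qint invr1 subrr mul0r scale0r addr0.
Qed.

(** The quadratic relation reads $(H_i-q^{-1})(H_i+q)=0$, so the shift $U_i=H_i-q^{-1}$ satisfies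
    $U_i^2=-(q+q^{-1})U_i$. *)
Definition tl_op n i : End_tpow K n :=
  if i is 0 then hecke_mx q n 0 else hecke_mx q n i - q^-1 *: 1%:M.

Lemma tl_op_pathv0 n b p : size p = n ->
  tl_op n.+1 0 *m pathv n.+1 1 (b :: p) =
  (if b then 1 else -1) *: pathv n.+1 1 (b :: p).
Proof.
move=> sp; rewrite [_ *m _]tensmx_ctens mul1mx -ctensZl; congr ctens.
apply/colP; apply: ord2P;
  rewrite !mxE !big_ord_recl !big_ord0 !mxE /= !big_ord_recl !big_ord0 !mxE /=;
  case: b; rewrite ?invr1; ring.
Qed.

(** [ucoef i] and [swap i] count steps from 0 and so belong to $U_{i+1}$. When the two steps differ,
    the coefficients of a path and of its exchange add up to the loop parameter, the trace of
    $U_{i+1}$ on the plane they span. *)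
Fixpoint ucoef i t (p : seq bool) : K :=
  match i, p with
  | 0, b :: c :: _ => if b == c then 0 else - (wd (step t b) / wd t)
  | i'.+1, b :: p' => ucoef i' (step t b) p'
  | _, _ => 0
  end.
Fixpoint swap i (p : seq bool) : seq bool :=
  match i, p with
  | 0, b :: c :: p' => c :: b :: p'
  | i'.+1, b :: p' => b :: swap i' p'
  | _, _ => p
  end.

Lemma tl_op1_slices m (v : 'cV[K]_(2 * (2 * tdim m))) :
  let w := (tl_op m.+2 1 : 'M[K]_(2 * (2 * tdim m))) *m v in
  let V a b := slice (slice v a) b in
  [/\ slice (slice w 0) 0 = 0,
      slice (slice w 0) 1 = V 1 0 - q^-1 *: V 0 1,
      slice (slice w 1) 0 = V 0 1 - q *: V 1 0
    & slice (slice w 1) 1 = 0].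
Proof.
rewrite /tl_op mulmxBl -scalemxAl mul1mx -scaleNr !(sliceD, sliceZ).
have [-> -> -> ->] := R_slices q v; split; apply/colP=> k; rewrite !mxE; ring.
Qed.

Lemma sliceN m r (s : 'cV[K]_(m * r)) a : slice (- s) a = - slice s a.
Proof. by rewrite -scaleN1r sliceZ scaleN1r. Qed.

Lemma tl_opS n i : tl_op n.+1 i.+2 = 1%:M *t tl_op n i.+1.
Proof.
have tBZ (A : 'M[K]_2) (B C : 'M[K]_(tdim n)) k :
    A *t (B - k *: C) = A *t B - k *: (A *t C).
  by apply/matrixP=> u v; rewrite !mxE; ring.
by rewrite /tl_op tBZ tensmx11.
Qed.

(** Induction strips the factors in front of the two that $U_{i+1}$ acts on; in these two the
    identity is checked on the four slices. *)
Lemma tl_op_pathv n i t p : qpow t -> size p = n -> (i.+1 < n)%N ->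
  tl_op n i.+1 *m pathv n t p = ucoef i t p *: (pathv n t p - pathv n t (swap i p)).
Proof.
elim: n i t p => [|[|n] IH] i t [|b [|c p]] // ht [sp] hi.
case: i hi => [|i] hi; last first.
  have vE r : pathv n.+2 t (b :: r) = ctens (pvec t b) (pathv n.+1 (step t b) r) by [].
  rewrite -[swap _ _]/(b :: swap i (c :: p)) !vE tl_opS tensmx_ctens mul1mx.
  rewrite IH //; first by rewrite ctensZr ctensBr.
    exact: qpow_step.
  by rewrite /= sp.
have t0 := qpow_neq0 ht; have ht' := qpow_step b ht.
have t0' := qpow_neq0 ht'; have w0 := wd_neq0 ht.
(* Both orders of the two steps reach the same point, so the two path vectors share the remaining
   tensor factor [w]. *)
have bcE : step (step t b) c = step (step t c) b.
  by rewrite /step; case: (b); case: (c) => //; field.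
have [S00 S01 S10 S11] := tl_op1_slices (pathv n.+2 t [:: b, c & p]).
rewrite /= -bcE in S00 S01 S10 S11 *.
move: (pathv n _ p) S00 S01 S10 S11 => w S00 S01 S10 S11.
apply: sliceP; apply: ord2P; apply: sliceP; apply: ord2P;
  rewrite ?S00 ?S01 ?S10 ?S11 !(sliceZ, sliceD, sliceN, slice_ctens) !pvecE.
all: have wE : wd t = (t ^+ 2 + 1) / t by rewrite /wd; field.
all: have tt0 : t ^+ 2 + 1 != 0 by move: w0; rewrite wE mulf_eq0 negb_or => /andP[].
all: rewrite wE /wd /step.
all: apply/colP=> k; rewrite !mxE; move: (w k 0) => z.
all: case: (b); case: (c) => /=; rewrite ?mul0r; field; rewrite ?t0 ?q0 ?tt0 //.
Qed.

(** * The Temperley-Lieb relations for the operators [tl_op] *)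

Definition opapp n (M : End_tpow K n) (v : tpow K n) : tpow K n := M *m v.
Definition tslice n (v : tpow K n.+1) a : tpow K n := @slice K 2 (tdim n) v a.

Lemma tslice_ext n (u v : tpow K n.+1) :
  tslice u 0 = tslice v 0 -> tslice u 1 = tslice v 1 -> u = v.
Proof. by move=> uv0 uv1; apply: (@sliceP K 2 (tdim n)); apply: ord2P. Qed.
Lemma opapp_ext n (M N : End_tpow K n) : (forall v, opapp M v = opapp N v) -> M = N.
Proof. exact: mulv_inj. Qed.
Lemma opappM n (M N : End_tpow K n) v : opapp (M * N) v = opapp M (opapp N v).
Proof. by rewrite /opapp mulmxA. Qed.
Lemma tsliceB n (u v : tpow K n.+1) a : tslice (u - v) a = tslice u a - tslice v a.
Proof. by rewrite /tslice -scaleN1r sliceD sliceZ scaleN1r. Qed.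
Lemma tsliceZ n k (v : tpow K n.+1) a : tslice (k *: v) a = k *: tslice v a.
Proof. exact: sliceZ. Qed.
Lemma tslice0 n a : tslice (0 : tpow K n.+1) a = 0.
Proof. by rewrite -[0 : tpow K n.+1](scale0r 0) tsliceZ scale0r. Qed.

Lemma opapp_tl1 m (v : tpow K m.+2) (w := opapp (tl_op m.+2 1) v) :
  ((tslice (tslice w 0) 0 = 0) *
   (tslice (tslice w 0) 1 = tslice (tslice v 1) 0 - q^-1 *: tslice (tslice v 0) 1) *
   (tslice (tslice w 1) 0 = tslice (tslice v 0) 1 - q *: tslice (tslice v 1) 0) *
   (tslice (tslice w 1) 1 = 0))%type.
Proof. by have [H1 H2 H3 H4] := @tl_op1_slices m v; do !split. Qed.

Lemma opapp_tl0 m (v : tpow K m.+1) (w := opapp (tl_op m.+1 0) v) :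
  ((tslice w 0 = tslice v 1) * (tslice w 1 = tslice v 0))%type.
Proof.
have tD (M N : 'M[K]_2) (O : 'M[K]_(tdim m)) : (M + N) *t O = M *t O + N *t O.
  by apply/matrixP=> i j; rewrite !mxE mulrDl.
rewrite /tslice /w /opapp /= /hecke_s0 !trmx_delta !mul_delta_mx tD mulmxDl.
by split; rewrite sliceD !delta_slice /= !mul1mx !(scale0r, scale1r, add0r, addr0).
Qed.

Lemma opapp_tlS m i (v : tpow K m.+1) a :
  tslice (opapp (tl_op m.+1 i.+2) v) a = opapp (tl_op m i.+1) (tslice v a).
Proof.
rewrite /tslice /opapp tl_opS tens_mulv (bigD1 a) //= big1 ?addr0 => [|b ba].
  by rewrite mxE eqxx scale1r.
by rewrite mxE eq_sym (negPf ba) scale0r.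
Qed.

Lemma opapp0 m (v : tpow K m) : opapp 0 v = 0. Proof. exact: mul0mx. Qed.

(** Shifts a cubic relation by one tensor factor, so that only its leftmost instance has to be
    computed on slices. *)
Lemma opapp_tlS_ext m i j k (Hijk : tl_op m i.+1 * tl_op m j.+1 * tl_op m i.+1 = tl_op m k.+1) :
  tl_op m.+1 i.+2 * tl_op m.+1 j.+2 * tl_op m.+1 i.+2 = tl_op m.+1 k.+2.
Proof.
by apply: opapp_ext => v; apply: tslice_ext; rewrite !opappM !opapp_tlS -!opappM Hijk.
Qed.

Lemma tl_op_loop n i : (1 <= i < n)%N ->
  tl_op n i * tl_op n i = - (q + q^-1) *: tl_op n i.
Proof.
case: i => [//|i] hi; have H := hecke_mx_quad q0 hi; rewrite /tl_op.
set h := hecke_mx q n i.+1 in H *.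
rewrite mulrBl !mulrBr H -!scalerAl -!scalerAr !mulr1 !mul1r scalerA.
by apply/matrixP=> a b; rewrite !mxE; field.
Qed.

Lemma tl_op_up n i : (1 <= i)%N -> (i.+1 < n)%N ->
  tl_op n i * tl_op n i.+1 * tl_op n i = tl_op n i.
Proof.
elim: n i => [//|n IH] [//|[|i]] _ hi; last by apply: opapp_tlS_ext; apply: IH.
case: n IH hi => [|[|n]] // IH _.
apply: opapp_ext => v; rewrite !opappM.
apply: tslice_ext; apply: tslice_ext; apply: tslice_ext;
  do ?rewrite ?opapp_tl1 ?opapp_tlS ?tsliceB ?tsliceZ ?tslice0;
  apply/colP=> k; rewrite !mxE; by field.
Qed.

Lemma tl_op_down n i : (1 <= i)%N -> (i.+1 < n)%N ->
  tl_op n i.+1 * tl_op n i * tl_op n i.+1 = tl_op n i.+1.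
Proof.
elim: n i => [//|n IH] [//|[|i]] _ hi; last by apply: opapp_tlS_ext; apply: IH.
case: n IH hi => [|[|n]] // IH _.
apply: opapp_ext => v; rewrite !opappM.
apply: tslice_ext; apply: tslice_ext; apply: tslice_ext;
  do ?rewrite ?opapp_tl1 ?opapp_tlS ?tsliceB ?tsliceZ ?tslice0;
  apply/colP=> k; rewrite !mxE; by field.
Qed.

(** The image of $U_1$ lies in $(x\otimes y-q\,y\otimes x)\otimes W$, which $s_0$ sends to
    $(y\otimes y-q\,x\otimes x)\otimes W$, where $U_1$ vanishes. *)
Lemma tl_op_blob n : tl_op n.+2 1 * tl_op n.+2 0 * tl_op n.+2 1 = 0.
Proof.
apply: opapp_ext => v; rewrite !opappM opapp0.
apply: tslice_ext; apply: tslice_ext;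
  do ?rewrite ?opapp_tl1 ?opapp_tl0 ?tsliceB ?tsliceZ ?tslice0;
  apply/colP=> k; rewrite !mxE; by field.
Qed.

Lemma tl_op_comm n i j : (i.+2 <= j)%N -> (j < n)%N ->
  tl_op n i * tl_op n j = tl_op n j * tl_op n i.
Proof.
move=> ij jn; have H := hecke_mx_comm q ij jn.
rewrite /tl_op; case: j ij jn H => [//|j] ij jn H; case: i ij H => [|i] ij H.
  by rewrite mulrBr mulrBl H -scalerAl -scalerAr mulr1 mul1r.
rewrite !mulrBr !mulrBl H -!scalerAl -!scalerAr !mulr1 !mul1r.
by move: (_ * _) => hh; apply/matrixP=> a b; rewrite !mxE; ring.
Qed.

Lemma tl_op_s0 n : tl_op n.+1 0 * tl_op n.+1 0 = 1.
Proof. exact: hecke_mx_quad0. Qed.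

(** * The representation of $\mathrm{TL}(B_n)$, its grading and its restriction along the tower *)

Definition delta := - (q + q^-1).

Definition tl_letter n (i : 'I_n) : End_tpow K n := tl_op n i.

Lemma tl_letterP n : satisfies (@tlB_rel K delta n) (@tl_letter n).
Proof.
move=> _ _ [i i0|i j i0 ij|i j i0 ij|i j i0 ij|i i0|i j i0 j1|i j i0 j2] /=;
  rewrite /tl_letter.
- by apply: tl_op_loop; rewrite i0 ltn_ord.
- by have := ltn_ord j; rewrite ij; apply: tl_op_up.
- by have := ltn_ord j; rewrite ij; apply: tl_op_down.
- exact: tl_op_comm.
- by rewrite i0; case: n i i0 => [[]//|n] i _; exact: tl_op_s0.
- rewrite i0 j1; case: n i j i0 j1 => [[]//|[|n]] i j _ j1.
    by case: j j1 => [[|//] ?].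
  exact: tl_op_blob.
- by rewrite i0; apply: tl_op_comm.
Qed.

Definition tl_rep n : tlB delta n -> End_tpow K n :=
  Defs.lift (P := tlB_presentation delta n) (@tl_letterP n).
HB.instance Definition _ n := GRing.LRMorphism.on (@tl_rep n).

Arguments pathv : simpl never.
Arguments pathd : simpl never.
Local Hint Resolve qpow_1 : core.
Local Notation rho n := (@tl_rep n).
Local Notation TL n := (tlB delta n).
Local Notation pv := (pathv _ 1).
Local Notation pd := (pathd _ 1).
Local Notation ct p := (count id p).

Lemma tl_rep_gen n i : (i < n)%N -> rho n (tlgen delta n i) = tl_op n i.
Proof. by move=> hi; rewrite -[i]/(val (Ordinal hi)) tlgenE /tl_rep lift_gen. Qed.

Lemma pd_pv n p r : size p = n -> size r = n ->
  pathd n 1 p *m pathv n 1 r = (p == r)%:R%:M.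
Proof. by move=> sp sr; apply: pathd_pathv. Qed.

Lemma mul_pathv_ext m n (M N : 'M[K]_(m, tdim n)) :
  (forall r, size r = n -> M *m pathv n 1 r = N *m pathv n 1 r) -> M = N.
Proof.
move=> MN; rewrite -[M]mulmx1 -[N]mulmx1 -(sum_pathv_pathd n qpow_1) !mulmx_sumr.
by apply: eq_bigr => p _; rewrite !mulmxA MN ?size_tuple.
Qed.

Lemma pathv_expand n (w : tpow K n) :
  w = \sum_(p : n.-tuple bool) (pathd n 1 p *m w) 0 0 *: pathv n 1 p.
Proof.
rewrite -{1}[w]mul1mx -(sum_pathv_pathd n qpow_1) mulmx_suml.
apply: eq_bigr => p _; rewrite -mulmxA [pd p *m w]mx11_scalar mul_mx_scalar.
by rewrite -mx11_scalar.
Qed.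

(* Paths of length n have the same endpoint if and only if they have as many steps up,
   so these are the functions of [B_op n]. *)
Definition grade_op n (f : nat -> K) : End_tpow K n :=
  \sum_(p : n.-tuple bool) f (ct p) *: (pathv n 1 p *m pathd n 1 p).

Lemma big_tuple_size (V : nmodType) n (F : seq bool -> V) r : size r = n ->
  (forall p, size p = n -> p != r -> F p = 0) ->
  \sum_(p : n.-tuple bool) F p = F r.
Proof.
move=> /eqP sr F0; rewrite (bigD1 (Tuple sr)) //= big1 ?addr0 // => p pr.
by apply: F0; rewrite ?size_tuple.
Qed.

Lemma grade_op_pathv n f r : size r = n ->
  grade_op n f *m pathv n 1 r = f (ct r) *: pathv n 1 r.
Proof.
move=> sr; rewrite mulmx_suml.
rewrite (@big_tuple_size _ n (fun p => f (ct p) *: (pathv n 1 p *m pathd n 1 p) *m pv r) r) //.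
  by rewrite -scalemxAl -mulmxA pd_pv // eqxx mulmx1.
move=> p sp /negPf pr; rewrite -scalemxAl -mulmxA pd_pv // pr.
by rewrite mul_mx_scalar !scale0r scaler0.
Qed.

Lemma size_swap i p : size (swap i p) = size p.
Proof. by elim: i p => [|i IH] [|b [|c p]] //=; rewrite IH. Qed.

Lemma count_swap i p : ct (swap i p) = ct p.
Proof. by elim: i p => [|i IH] [|b [|c p]] //=; rewrite ?IH // addnCA. Qed.

(** On the path basis $s_0$ is diagonal and $U_i$ only mixes a path with its [swap], which has as
    many steps up. *)
Lemma tl_rep_grade n (x : TL n) f : rho n x * grade_op n f = grade_op n f * rho n x.
Proof.
elim/tlB_ind: x => [|i hi|k u v IHu IHv|u v IHu IHv].
- by rewrite rmorph1 mulr1 mul1r.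
- rewrite tl_rep_gen //; apply: mul_pathv_ext => r sr.
  rewrite -!mulmxA grade_op_pathv // -scalemxAr.
  case: i hi => [|i] hi.
    case: n r sr hi => [//|n] [//|b r] [sr] _.
    rewrite tl_op_pathv0 // -scalemxAr grade_op_pathv; last by rewrite /= sr.
    by rewrite !scalerA mulrC.
  rewrite tl_op_pathv // -scalemxAr mulmxBr !grade_op_pathv ?size_swap //.
  by rewrite count_swap -scalerBr !scalerA mulrC.
- by rewrite linearP mulrDl mulrDr -scalerAl -scalerAr IHu IHv.
- by rewrite rmorphM -mulrA IHv mulrA IHu -mulrA.
Qed.

(* Paths are built from the front, as [tpow] is, while [tlemb] concerns the last factor. *)
Definition snoc_op n (b : bool) : 'M[K]_(tdim n.+1, tdim n) :=
  \sum_(p : n.-tuple bool) pathv n.+1 1 (rcons p b) *m pathd n 1 p.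

Lemma snoc_op_pathv n b r : size r = n ->
  snoc_op n b *m pathv n 1 r = pathv n.+1 1 (rcons r b).
Proof.
move=> sr; rewrite mulmx_suml.
rewrite (@big_tuple_size _ n (fun p => (pathv n.+1 1 (rcons p b) *m pathd n 1 p) *m pv r) r) //.
  by rewrite -mulmxA pd_pv // eqxx mulmx1.
move=> p sp /negPf pr; rewrite -mulmxA pd_pv // pr.
by rewrite mul_mx_scalar scale0r.
Qed.

Lemma swap_rcons i p b : (i.+1 < size p)%N -> swap i (rcons p b) = rcons (swap i p) b.
Proof. by elim: i p => [|i IH] [|c [|d p]] //= hi; rewrite -IH. Qed.

Lemma ucoef_rcons i t p b : (i.+1 < size p)%N -> ucoef i t (rcons p b) = ucoef i t p.
Proof. by elim: i t p => [|i IH] t [|c [|d p]] //= hi; apply: (IH _ (d :: p)). Qed.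

(** The generators of [TL n] read and exchange only the first [n] steps, so appending a last step
    intertwines the two actions. *)
Lemma tl_rep_snoc n (x : TL n) b :
  rho n.+1 (tlemb x) *m snoc_op n b = snoc_op n b *m rho n x.
Proof.
elim/tlB_ind: x => [|i hi|k u v IHu IHv|u v IHu IHv].
- by rewrite !rmorph1 mulmx1 [LHS]mul1mx.
- rewrite tlemb_gen // !tl_rep_gen //; last exact: ltnW.
  apply: mul_pathv_ext => r sr; rewrite -!mulmxA snoc_op_pathv //.
  case: i hi => [|i] hi.
    case: n r sr hi => [//|n] [//|c r] [sr] _; rewrite rcons_cons.
    rewrite tl_op_pathv0 ?size_rcons ?sr // tl_op_pathv0 // -scalemxAr.
    by rewrite snoc_op_pathv ?rcons_cons //= sr.
  rewrite !tl_op_pathv ?size_rcons ?sr // ?(leqW hi) // -scalemxAr mulmxBr.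
  by rewrite swap_rcons ?ucoef_rcons ?sr // !snoc_op_pathv ?size_swap.
- by rewrite !linearP /= mulmxDl -scalemxAl IHu IHv.
- by rewrite !rmorphM -mulmxA IHv mulmxA IHu -mulmxA.
Qed.

(** This means a matrix unit, not an invertible element: [x] acts as $E_{p,r}$ in the path basis. *)
Definition is_unit n (x : TL n) (p r : seq bool) := forall s, size s = n ->
  rho n x *m pathv n 1 s = (r == s)%:R *: pathv n 1 p.

Lemma tlemb_is_unit n (x : TL n) p r s b : is_unit x p r -> size p = n -> size s = n ->
  rho n.+1 (tlemb x) *m pathv n.+1 1 (rcons s b)
  = (r == s)%:R *: pathv n.+1 1 (rcons p b).
Proof.
move=> xu sp ss; rewrite -snoc_op_pathv // mulmxA tl_rep_snoc -mulmxA xu //.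
by rewrite -scalemxAr snoc_op_pathv.
Qed.

Definition lastcoef (s : seq bool) b :=
  - (wd (step (foldl step 1 s) b) / wd (foldl step 1 s)).

Lemma qpow_foldl t s : qpow t -> qpow (foldl step t s).
Proof. by elim: s t => [|b s IH] t ht //=; apply/IH/qpow_step. Qed.

Lemma lastcoef_neq0 s b : lastcoef s b != 0.
Proof.
have H := qpow_foldl s qpow_1.
by rewrite oppr_eq0 mulf_neq0 ?invr_eq0 ?wd_neq0 //; apply: qpow_step.
Qed.

Lemma tl_rep_last n s b c : size s = n ->
  rho n.+2 (tlgen delta n.+2 n.+1) *m pathv n.+2 1 (rcons (rcons s b) c) =
  (if b == c then 0 else lastcoef s b)
    *: (pathv n.+2 1 (rcons (rcons s b) c) - pathv n.+2 1 (rcons (rcons s c) b)).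
Proof.
move=> ss; rewrite tl_rep_gen // tl_op_pathv ?size_rcons ?ss //.
have -> : swap n (rcons (rcons s b) c) = rcons (rcons s c) b.
  by rewrite -ss; elim: s {ss} => //= d s ->.
congr (_ *: _); rewrite /lastcoef -{n}ss.
by elim: s (1 : K) => //= d s IH t; rewrite IH.
Qed.

(** * Matrix units and faithfulness *)

Definition tl_units n := forall p r, size p = n -> size r = n -> ct p = ct r ->
  exists x : TL n, is_unit x p r.

Definition unit_family n (E : seq bool -> seq bool -> TL n) := forall p r,
  size p = n -> size r = n -> ct p = ct r -> is_unit (E p r) p r.

Lemma unit_familyP n : tl_units n -> exists E, @unit_family n E.
Proof.
move=> U; have /choice[E HE] : forall pr : seq bool * seq bool, exists x : TL n,
    size pr.1 = n -> size pr.2 = n -> ct pr.1 = ct pr.2 -> is_unit x pr.1 pr.2.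
  move=> [p r] /=; case: (boolP [&& size p == n, size r == n & ct p == ct r]).
    by case/and3P=> /eqP sp /eqP sr /eqP pr; have [x xu] := U p r sp sr pr; exists x.
  move=> N; exists 0 => sp sr pr; move: N.
  by rewrite sp sr pr !eqxx.
by exists (fun p r => E (p, r)) => p r; apply: (HE (p, r)).
Qed.

Lemma pd_grade n p f : size p = n -> pathd n 1 p *m grade_op n f = f (ct p) *: pathd n 1 p.
Proof.
move=> sp; apply: mul_pathv_ext => r sr.
rewrite -mulmxA grade_op_pathv // -scalemxAr -scalemxAl pd_pv //.
by case: eqP => [->//|_]; rewrite !scale_scalar_mx !mulr0.
Qed.

(** For [f] the indicator of [ct p], [grade_op n f] is a projection that fixes the dual vector of
    [p] and kills the vector of [r]; moving it through [M] gives 0. *)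
Lemma graded_entry n (M : End_tpow K n) p r :
  (forall f, M * grade_op n f = grade_op n f * M) ->
  size p = n -> size r = n -> ct p != ct r -> (pathd n 1 p *m (M *m pathv n 1 r)) 0 0 = 0.
Proof.
move=> MG sp sr pr; pose f k : K := (k == ct p)%:R.
have <- : pathd n 1 p *m grade_op n f = pathd n 1 p by rewrite pd_grade // /f eqxx scale1r.
have H : grade_op n f *m M = M *m grade_op n f by rewrite -[LHS]MG.
rewrite -mulmxA [grade_op n f *m _]mulmxA H -mulmxA grade_op_pathv // /f eq_sym (negPf pr).
by rewrite scale0r !mulmx0 mxE.
Qed.

(** By [graded_entry], [M] is block diagonal for the number of steps up, and matrix units are
    available inside each block. *)
Lemma unit_family_expand n E (M : End_tpow K n) : @unit_family n E ->
  (forall f, M * grade_op n f = grade_op n f * M) ->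
  M = rho n (\sum_(p : n.-tuple bool) \sum_(r : n.-tuple bool | ct p == ct r)
              (pathd n 1 p *m (M *m pathv n 1 r)) 0 0 *: E p r).
Proof.
move=> EU MG; apply: mul_pathv_ext => s /[dup] ss /eqP ss'.
rewrite [LHS]pathv_expand linear_sum mulmx_suml; apply: eq_bigr => p _.
rewrite linear_sum mulmx_suml.
have [ps|ps] := eqVneq (ct p) (ct s); last first.
  rewrite graded_entry ?size_tuple // scale0r big1 // => r /eqP pr.
  rewrite linearZ -scalemxAl EU ?size_tuple //.
  have [rs|_] := eqVneq (val r) s; last by rewrite scale0r scaler0.
  by rewrite -rs pr eqxx in ps.
rewrite (bigD1 (Tuple ss')) ?ps //= big1 ?addr0 => [|r /andP[/eqP pr rs]].
  by rewrite linearZ -scalemxAl EU ?size_tuple //= eqxx scale1r.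
rewrite linearZ -scalemxAl EU ?size_tuple ?ps //.
case: eqVneq => [rs'|_]; last by rewrite scale0r scaler0.
by case/eqP: rs; apply/val_inj.
Qed.

Lemma unit_family_span n E (x : TL n) : injective (@tl_rep n) -> @unit_family n E ->
  x = \sum_(p : n.-tuple bool) \sum_(r : n.-tuple bool | ct p == ct r)
        (pathd n 1 p *m (rho n x *m pathv n 1 r)) 0 0 *: E p r.
Proof. by move=> inj EU; apply/inj/unit_family_expand => //; apply: tl_rep_grade. Qed.

Lemma is_unit_eq n (x y : TL n) : injective (@tl_rep n) ->
  (forall s, size s = n -> rho n x *m pathv n 1 s = rho n y *m pathv n 1 s) -> x = y.
Proof. by move=> inj xy; apply/inj/mul_pathv_ext. Qed.

Lemma add_sub_eq0 (k l : K) : k + l = 0 -> k - l = 0 -> k = 0 /\ l = 0.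
Proof.
move=> kl1 kl2; have k0 : k = 0.
  have : 2%:R * k = (k + l) + (k - l) by ring.
  rewrite kl1 kl2 addr0 => /eqP.
  by rewrite mulf_eq0 (negPf two_neq0) /= => /eqP.
by split=> //; move: kl1; rewrite k0 add0r.
Qed.

(** * The induction step from levels $n$ and $n+1$ to level $n+2$ *)

Section Step.
Variable n : nat.
Hypothesis inj1 : injective (@tl_rep n.+1).
Variables (E0 : seq bool -> seq bool -> TL n) (E1 : seq bool -> seq bool -> TL n.+1).
Hypotheses (E0U : unit_family E0) (E1U : unit_family E1).

Let U : TL n.+2 := tlgen delta n.+2 n.+1.
Let I := (n.+1.-tuple bool * bool)%type.
Let word (i : I) := rcons i.1 i.2.
Let deg (i : I) := (ct i.1 + i.2)%N.

Let size_word i : size (word i) = n.+2. Proof. by rewrite size_rcons size_tuple. Qed.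
Let ct_rcons s b : ct (rcons s b) = (ct s + b)%N.
Proof. by rewrite -cats1 count_cat /= addn0. Qed.
Let ct_word i : ct (word i) = deg i. Proof. exact: ct_rcons. Qed.
Let word_inj : injective word.
Proof.
move=> [p a] [r b] /rcons_inj [pr ab]; congr (_, _) => //.
exact/val_inj.
Qed.

(** A representative of the paths of length [n] with [k] steps up, to which [mid_swap] reduces all
    inner paths. *)
Definition mid k := nseq k true ++ nseq (n - k) false.
Let size_mid k : (k <= n)%N -> size (mid k) = n.
Proof. by move=> kn; rewrite size_cat !size_nseq subnKC. Qed.
Let ct_mid k : ct (mid k) = k.
Proof. by rewrite count_cat !count_nseq /= mul1n mul0n addn0. Qed.

(* Acts, up to a nonzero scalar, as the matrix unit at ([word i], [word j]). *)
Let sandwich k (i j : I) : TL n.+2 :=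
  tlemb (E1 i.1 (rcons (mid k) (~~ i.2))) * U * tlemb (E1 (rcons (mid k) (~~ j.2)) j.1).

(** $U$ returns a path minus its exchange. The left matrix unit selects the path itself when
    [i.2 = j.2] and the exchanged one otherwise, whence the sign. *)
Let coef k (i j : I) := (if i.2 == j.2 then 1 else -1) * lastcoef (mid k) (~~ j.2).

Let coef_neq0 k i j : coef k i j != 0.
Proof.
by rewrite /coef mulf_neq0 ?lastcoef_neq0 //; case: ifP; rewrite ?oppr_eq0 oner_eq0.
Qed.

(** The right matrix unit leaves [rcons (mid k) (~~ j.2)] followed by the last step of [s]. If that
    step is not [j.2], the last two steps agree and $U$ gives 0. *)
Let sandwich_pathv k i j s : (k <= n)%N -> deg i = k.+1 -> deg j = k.+1 -> size s = n.+2 ->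
  rho n.+2 (sandwich k i j) *m pathv n.+2 1 s =
  (coef k i j * (word j == s)%:R) *: pathv n.+2 1 (word i).
Proof.
case: i j => [p a] [r b] /= kn di dj.
have flip c (d : bool) : (c + d)%N = k.+1 -> c = (k + ~~ d)%N.
  by case: d; rewrite /= ?addn1 ?addn0 // => -[].
have ctm c : ct (rcons (mid k) c) = (k + c)%N by rewrite ct_rcons ct_mid.
have szm c : size (rcons (mid k) c) = n.+1 by rewrite size_rcons size_mid.
have Ep : is_unit (E1 p (rcons (mid k) (~~ a))) p (rcons (mid k) (~~ a)).
  by apply: E1U; rewrite ?szm ?size_tuple // ctm; apply: flip.
have Er : is_unit (E1 (rcons (mid k) (~~ b)) r) (rcons (mid k) (~~ b)) r.
  by apply: E1U; rewrite ?szm ?size_tuple // ctm; apply/esym/flip.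
case/lastP: s => [//|s d]; rewrite size_rcons => -[ss].
rewrite /sandwich !rmorphM -!mulmxA /= (tlemb_is_unit _ Er) // -!scalemxAr.
rewrite tl_rep_last ?size_mid // /word /= eqseq_rcons.
case: (val r == s); last by rewrite /= mulr0 !scale0r.
rewrite -!scalemxAr mulmxBr !(tlemb_is_unit _ Ep) ?szm ?size_tuple //.
rewrite !eqseq_rcons !eqxx /= !scale1r /coef.
have -> : (b == d) = ~~ (~~ b == d) by case: (b) (d) => [] [].
case: eqP => [_|bd] /=; first by rewrite mulr0 !scale0r.
have -> : d = b by case: (b) (d) bd => [] [].
by case: (a) (b) => [] [] /=; rewrite ?(scale1r, scale0r, subr0, mulr1, mul1r, sub0r, mulN1r, scaleNr, scalerN).
Qed.

(* The last generator commutes with the matrix units of length n, so that a product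
   E U E' depends on the inner paths only through their number of steps up. *)
Let mid_swap (s t p r : seq bool) (e d : bool) k :
  size s = n -> size t = n -> size p = n.+1 -> size r = n.+1 ->
  ct p = ct (rcons s e) -> ct r = ct (rcons t d) -> ct s = k ->
  tlemb (E1 p (rcons s e)) * U * tlemb (E1 (rcons t d) r) =
  (s == t)%:R *: (tlemb (E1 p (rcons (mid k) e)) * U * tlemb (E1 (rcons (mid k) d) r)).
Proof.
move=> ss st sp sr cp cr cs.
have kn : (k <= n)%N by rewrite -cs -ss count_size.
have szm c : size (rcons (mid k) c) = n.+1 by rewrite size_rcons size_mid.
have szs c : size (rcons s c) = n.+1 by rewrite size_rcons ss.
have szt c : size (rcons t c) = n.+1 by rewrite size_rcons st.
have ctm c : ct (rcons (mid k) c) = ct (rcons s c) by rewrite !ct_rcons ct_mid cs.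
have E0m : is_unit (E0 (mid k) s) (mid k) s.
  by apply: E0U; rewrite ?size_mid // ct_mid cs.
have E1p : is_unit (E1 p (rcons s e)) p (rcons s e) by apply: E1U.
have E1m : is_unit (E1 p (rcons (mid k) e)) p (rcons (mid k) e).
  by apply: E1U; rewrite ?szm // ctm.
have -> : E1 p (rcons s e) = E1 p (rcons (mid k) e) * tlemb (E0 (mid k) s).
  apply: is_unit_eq => //; case/lastP=> [//|v c]; rewrite size_rcons => -[sv].
  rewrite rmorphM -mulmxA (tlemb_is_unit _ E0m) ?size_mid // -scalemxAr.
  rewrite E1p ?size_rcons ?sv // E1m ?szm // scalerA -natrM mulnb !eqseq_rcons.
  by rewrite eqxx andTb andbC.
rewrite rmorphM -[_ * tlemb (tlemb _) * U]mulrA -tlemb_comm -!mulrA -rmorphM.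
have -> : tlemb (E0 (mid k) s) * E1 (rcons t d) r =
    (s == t)%:R *: E1 (rcons (mid k) d) r.
  apply: is_unit_eq => // v sv.
  rewrite rmorphM -mulmxA E1U // -scalemxAr (tlemb_is_unit _ E0m) ?size_mid //.
  rewrite [in RHS]linearZ /= -scalemxAl.
  case: (eqVneq s t) => [st'|_]; last by rewrite !scale0r scaler0.
  by rewrite E1U // -?st' ?ctm ?st' // !scale1r.
by rewrite /= linearZ /= -!scalerAr.
Qed.

Let ok i j := (deg i == deg j) && (0 < deg i < n.+2)%N.
(** The steps [~~ i.2] and [i.2] contribute exactly one step up, which leaves [(deg i).-1] for the
    inner path; the bounds in [ok] make this a number between 0 and [n]. *)
Let S i j := sandwich (deg i).-1 i j.

Let spanned (u : TL n.+2) := exists c : I -> I -> K,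
  u = \sum_i \sum_(j | ok i j) c i j *: S i j.

Let spanned_lin k u v : spanned u -> spanned v -> spanned (k *: u + v).
Proof.
move=> [c ->] [d ->]; exists (fun i j => k * c i j + d i j).
rewrite scaler_sumr -big_split; apply: eq_bigr => i _ /=.
rewrite scaler_sumr -big_split; apply: eq_bigr => j _ /=.
by rewrite scalerA -scalerDl.
Qed.

Let spanned0 : spanned 0.
Proof.
by exists (fun _ _ => 0); rewrite big1 // => i _; rewrite big1 // => j _; rewrite scale0r.
Qed.

Let spannedZ k u : spanned u -> spanned (k *: u).
Proof. by move=> Su; rewrite -[_ *: _]addr0; apply: spanned_lin. Qed.

Let spanned_sum (J : finType) (P : pred J) (F : J -> TL n.+2) :
  (forall j, P j -> spanned (F j)) -> spanned (\sum_(j | P j) F j).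
Proof.
move=> SF; apply: big_ind => // u v Su Sv.
by rewrite -[u]scale1r; apply: spanned_lin.
Qed.

Let spannedS i j : ok i j -> spanned (S i j).
Proof.
move=> okij; exists (fun i' j' => ((i' == i) && (j' == j))%:R).
rewrite (bigD1 i) //= [X in _ + X]big1 ?addr0 => [|i' /negPf ii]; last first.
  by rewrite big1 // => j' _; rewrite ii scale0r.
rewrite (bigD1 j) //= big1 ?addr0 => [|j' /andP[_ /negPf jj]]; last first.
  by rewrite jj andbF scale0r.
by rewrite !eqxx scale1r.
Qed.

(** Expanding both outer factors in matrix units of level $n+1$ leaves products
    $E_{p,se}\,U\,E_{td,r'}$. By [mid_swap] these vanish unless $s=t$, and otherwise equal [S] at
    [(p, ~~ e)] and [(r', ~~ d)]. *)
Let tlideal_spanned u : tlideal u -> spanned u.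
Proof.
elim=> [x y|k {}u v _ Su _ Sv]; last exact: spanned_lin.
rewrite (unit_family_span x inj1 E1U) (unit_family_span y inj1 E1U).
rewrite linear_sum !mulr_suml; apply: spanned_sum => p _.
rewrite linear_sum !mulr_suml; apply: spanned_sum => r /eqP pr.
rewrite linear_sum mulr_sumr; apply: spanned_sum => p' _.
rewrite linear_sum mulr_sumr; apply: spanned_sum => r' /eqP pr'.
rewrite !linearZ -!scalerAl -scalerAr /=; do 2 apply: spannedZ.
move: (size_tuple r) (size_tuple p') pr pr'.
case/lastP: (val r) => [//|s e]; case/lastP: (val p') => [//|t d].
rewrite !size_rcons => -[ss] [st] pr pr'.
rewrite (mid_swap ss st (size_tuple p) (size_tuple r') pr (esym pr') erefl).
case: eqP => [st'|_]; last by rewrite scale0r.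
rewrite scale1r; have := @spannedS (p, ~~ e) (r', ~~ d).
rewrite /S /sandwich /ok /deg /= pr -pr' !ct_rcons st' !negbK.
have eK (b : bool) : (b + ~~ b = 1)%N by case: b.
rewrite -!addnA !eK addn1 /=; apply.
by rewrite eqxx !ltnS -st count_size.
Qed.

Let S_pathv i j s : ok i j -> size s = n.+2 -> rho n.+2 (S i j) *m pathv n.+2 1 s =
  (coef (deg i).-1 i j * (word j == s)%:R) *: pathv n.+2 1 (word i).
Proof.
case/and3P=> /eqP ij i0 i1 ss; apply: sandwich_pathv => //.
- by rewrite -ltnS prednK.
- by rewrite prednK.
- by rewrite -ij prednK.
Qed.

Let s0_nseq b : rho n.+2 (tlgen delta n.+2 0) *m pathv n.+2 1 (nseq n.+2 b)
  = (if b then 1 else -1) *: pathv n.+2 1 (nseq n.+2 b).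
Proof. by rewrite tl_rep_gen //; apply: (@tl_op_pathv0 _ b _ (size_nseq n.+1 b)). Qed.

Let ok_nseq i j b : ok i j -> (word j == nseq n.+2 b) = false.
Proof.
case/and3P=> /eqP ij i0 i1; apply/eqP=> /(congr1 (count id)).
rewrite ct_word count_nseq -ij => ib; move: i0 i1; rewrite ib.
by case: (b); rewrite ?mul1n ?mul0n ?ltnn // => _; rewrite ltnn.
Qed.

(** A kernel element is $k+l\,s_0+v$ with $v$ spanned by the [S i j]. On the two constant paths $v$
    vanishes and $s_0$ is $\pm1$, so $k\pm l=0$; the coefficients of $v$ are then read off as matrix
    entries. *)
Lemma tl_rep_inj_step : injective (@tl_rep n.+2).
Proof.
apply: raddf_inj => x.
have [k [l [u [/tlideal_spanned [c ->] ->]]]] := tlB_decomp x.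
set v := (X in _ + X) => x0.
have vE s : size s = n.+2 -> rho n.+2 v *m pathv n.+2 1 s =
    \sum_i \sum_(j | ok i j) (c i j * coef (deg i).-1 i j * (word j == s)%:R)
      *: pathv n.+2 1 (word i).
  move=> ss; rewrite linear_sum mulmx_suml; apply: eq_bigr => i _.
  rewrite linear_sum mulmx_suml; apply: eq_bigr => j okij.
  by rewrite linearZ -scalemxAl S_pathv // scalerA mulrA.
have v_nseq b : rho n.+2 v *m pathv n.+2 1 (nseq n.+2 b) = 0.
  rewrite vE ?size_nseq // big1 // => i _; rewrite big1 // => j okij.
  by rewrite (ok_nseq b okij) mulr0 scale0r.
have kl b : k + l * (if b then 1 else -1) = 0.
  have := v_nseq b; have := s0_nseq b; have := size_nseq n.+2 b.
  move: (nseq n.+2 b) => w sw s0w vw.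
  have := congr1 (fun M : End_tpow K n.+2 =>
    pathd n.+2 1 w *m (M *m pathv n.+2 1 w)) x0.
  rewrite mul0mx mulmx0 !raddfD /= !linearZ /= rmorph1 !mulmxDl vw addr0.
  rewrite -!scalemxAl s0w mul1mx scalerA -scalerDl -scalemxAr.
  rewrite [_ *m _](pd_pv sw sw) eqxx => /matrixP /(_ 0 0).
  by rewrite !mxE mulr1.
have [k0 l0] : k = 0 /\ l = 0.
  by apply: add_sub_eq0; [rewrite -(kl true) mulr1 | rewrite -(kl false) mulrN1].
rewrite k0 l0 !scale0r !add0r in x0 *.
rewrite /v big1 // => i _; rewrite big1 // => j okij.
(* In the entry at [word i] and [word j] only one term survives, because [word] is injective, and
   its factor [coef] is nonzero. *)
have := congr1 (fun M : End_tpow K n.+2 =>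
  pathd n.+2 1 (word i) *m (M *m pathv n.+2 1 (word j))) x0.
rewrite mul0mx mulmx0 vE // mulmx_sumr (bigD1 i) //= [X in _ + X]big1 ?addr0; last first.
  move=> i' i'i; rewrite mulmx_sumr big1 // => j' _.
  rewrite -scalemxAr [_ *m _](pd_pv (size_word i) (size_word i')).
  by rewrite [word i == _](inj_eq word_inj) [i == _]eq_sym (negPf i'i) scale_scalar_mx mulr0 raddf0.
rewrite mulmx_sumr (bigD1 j) //= big1 ?addr0; last first.
  move=> j' /andP[_ j'j].
  by rewrite (inj_eq word_inj) (negPf j'j) mulr0 scale0r mulmx0.
rewrite -scalemxAr [_ *m _](pd_pv (size_word i) (size_word i)) !eqxx => /matrixP /(_ 0 0).
rewrite !mxE !mulr1 => /eqP; rewrite mulf_eq0 (negPf (coef_neq0 _ _ _)) orbF => /eqP ->.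
by rewrite scale0r.
Qed.


Let ct_extremal s : size s = n.+2 -> ~~ (0 < ct s < n.+2)%N ->
  s = nseq n.+2 (0 < ct s)%N.
Proof.
move=> ss; have := count_size id s; rewrite ss => cs.
rewrite -{1}[s]/(id s) -ss; case: (posnP (ct s)) => [c0 _|c_gt0] /=.
  apply/all_pred1P; have : ~~ has id s by rewrite has_count c0.
  by rewrite -all_predC; apply: sub_all => -[].
rewrite -leqNgt ss => cn; have : all id s by rewrite all_count ss eqn_leq cs cn.
by move=> Hs; rewrite -ss; apply/all_pred1P; apply: sub_all Hs => -[].
Qed.

(* Acts as the projection killing the two constant paths. *)
Let proper_sum := \sum_(i | ok i i) (coef (deg i).-1 i i)^-1 *: S i i.

Let proper_sum_pathv s : size s = n.+2 -> rho n.+2 proper_sum *m pathv n.+2 1 s =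
  (0 < ct s < n.+2)%N%:R *: pathv n.+2 1 s.
Proof.
move=> ss; rewrite linear_sum mulmx_suml.
have [i0 si0] : exists i0, s = word i0.
  move: ss; case/lastP: s => [//|s b]; rewrite size_rcons => -[/eqP ss].
  by exists (Tuple ss, b).
have iE i : ok i i -> rho n.+2 ((coef (deg i).-1 i i)^-1 *: S i i) *m pathv n.+2 1 s
    = (word i == s)%:R *: pathv n.+2 1 (word i).
  by move=> oki; rewrite linearZ /= -scalemxAl S_pathv // scalerA mulKf.
rewrite (eq_bigr _ iE) (bigID (pred1 i0)) /= [X in _ + X]big1 ?addr0; last first.
  move=> i /andP[_ /negPf ii0].
  by rewrite si0 (inj_eq word_inj) ii0 scale0r.
have okE : ok i0 i0 = (0 < ct s < n.+2)%N by rewrite /ok eqxx si0 ct_word.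
case oki0: (0 < ct s < n.+2)%N; rewrite oki0 in okE.
  rewrite (big_pred1 i0) => [|i /=]; first by rewrite -si0 eqxx.
  by case: eqVneq => [->|]; rewrite ?okE ?andbF.
rewrite big_pred0 ?scale0r // => i.
by case: eqVneq => [->|]; rewrite ?okE ?andbF.
Qed.

(** For nonconstant paths a rescaled [S i j] works. The two constant paths are isolated by
    [1 - proper_sum] and told apart by the sign of $s_0$. *)
Lemma tl_units_step : tl_units n.+2.
Proof.
move=> p r sp sr pr.
have [pN|pN] := boolP (0 < ct p < n.+2)%N.
  move: sp sr pr pN; case/lastP: p => [//|p a]; case/lastP: r => [//|r b].
  rewrite !size_rcons => -[/eqP sp] [/eqP sr]; pose i : I := (Tuple sp, a).
  pose j : I := (Tuple sr, b).
  rewrite -[rcons p a]/(word i) -[rcons r b]/(word j) !ct_word => ij i0.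
  exists ((coef (deg i).-1 i j)^-1 *: S i j) => s ss.
  by rewrite linearZ /= -scalemxAl S_pathv ?scalerA ?mulKf // /ok ij eqxx -ij.
have rN := pN; rewrite pr in rN.
(* A constant path is determined by its number of steps up, so only diagonal matrix units remain. *)
have pE := ct_extremal sp pN; have rE := ct_extremal sr rN.
have {rE} rE : r = p by rewrite pE rE pr.
pose b := (0 < ct p)%N; pose sg (c : bool) : K := if c then 1 else -1.
exists ((1 - proper_sum) * (2%:R^-1 *: (1 + sg b *: tlgen delta n.+2 0))) => s ss.
have xE : rho n.+2 (2%:R^-1 *: (1 + sg b *: tlgen delta n.+2 0))
    = 2%:R^-1 *: (1 + sg b *: tl_op n.+2 0).
  by rewrite linearZ /= linearD /= linearZ /= rmorph1 tl_rep_gen.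
rewrite rmorphM -mulmxA [X in _ *m (X *m _)]xE.
have s0E : tl_op n.+2 0 *m pathv n.+2 1 s = sg (head true s) *: pathv n.+2 1 s.
  by case: s ss => [//|c s] [ss]; apply: tl_op_pathv0.
rewrite -scalemxAl mulmxDl -scalemxAl mul1mx s0E scalerA.
rewrite -[X in _ *m (_ *: (X + _))]scale1r -scalerDl scalerA.
rewrite -scalemxAr rmorphB rmorph1 mulmxBl mul1mx proper_sum_pathv //.
have -> : 2%:R^-1 * (1 + sg b * sg (head true s)) = (b == head true s)%:R.
  rewrite /sg; case: (b) (head true s) => [] [] /=;
    rewrite ?mulr1 ?mul1r ?mulrNN ?mulr1 ?subrr ?mulr0 //; exact: mulVf.
rewrite -[X in X - _]scale1r -scalerBl scalerA rE.
have [<-|ps] := eqVneq p s.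
  have -> : (0 < ct p < n.+2)%N = false by apply/negbTE.
  have -> : b == head true p by rewrite pE.
  by rewrite subr0 mulr1.
have [sN|sN] := boolP (0 < ct s < n.+2)%N; first by rewrite subrr mulr0 !scale0r.
have sE := ct_extremal ss sN.
have [bs|_] := eqVneq b (head true s); last by rewrite mul0r !scale0r.
by case/eqP: ps; rewrite pE -/b bs sE.
Qed.

End Step.

Lemma tl_rep_inj0 : injective (@tl_rep 0).
Proof.
apply: raddf_inj => x.
have [k ->] : exists k, x = k%:A.
  elim/tlB_ind: x => [|//|k u v [a ->] [b ->]|u v [a ->] [b ->]].
  - by exists 1; rewrite scale1r.
  - by exists (k * a + b); rewrite scalerA -scalerDl.
  - by exists (a * b); rewrite -scalerAl mul1r scalerA.
rewrite /= linearZ /= rmorph1 => /matrixP /(_ 0 0).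
by rewrite !mxE mulr1 => ->; rewrite scale0r.
Qed.

Lemma tl_units0 : tl_units 0.
Proof.
by move=> [|//] [|//] _ _ _; exists 1 => -[|//] _; rewrite rmorph1 mul1mx scale1r.
Qed.

Lemma tl_rep1_pathv k l b : rho 1 (k%:A + l *: tlgen delta 1 0) *m pathv 1 1 [:: b]
  = (k + l * (if b then 1 else -1)) *: pathv 1 1 [:: b].
Proof.
have -> : rho 1 (k%:A + l *: tlgen delta 1 0) = k *: 1 + l *: tl_op 1 0.
  by rewrite linearD /= !linearZ /= rmorph1 tl_rep_gen.
by rewrite mulmxDl -!scalemxAl mul1mx tl_op_pathv0 // scalerA -scalerDl.
Qed.

Lemma tl_rep_inj1 : injective (@tl_rep 1).
Proof.
apply: raddf_inj => x; have [k [l ->]] := tlB1_decomp x => x0.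
have kl b : k + l * (if b then 1 else -1) = 0.
  have := congr1 (fun M : End_tpow K 1 => pathd 1 1 [:: b] *m (M *m pathv 1 1 [:: b])) x0.
  rewrite mul0mx mulmx0 tl_rep1_pathv -scalemxAr pd_pv // eqxx => /matrixP /(_ 0 0).
  by rewrite !mxE mulr1.
have [-> ->] : k = 0 /\ l = 0.
  by apply: add_sub_eq0; [rewrite -(kl true) mulr1 | rewrite -(kl false) mulrN1].
by rewrite !scale0r addr0.
Qed.

Lemma tl_units1 : tl_units 1.
Proof.
move=> [//|b [|//]] [//|c [|//]] _ _; rewrite /= !addn0 => bc.
have {bc} -> : c = b by case: b c bc => [] [].
exists (2%:R^-1%:A + (2%:R^-1 * (if b then 1 else -1)) *: tlgen delta 1 0).
move=> [//|d [|//]] _; rewrite tl_rep1_pathv -mulrA -{1}[2%:R^-1]mulr1 -mulrDr.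
case: b d => [] [];
  rewrite ?mulr1 ?mul1r ?mulrNN ?mulr1 ?subrr ?mulr0 ?scale0r //= ?mulVf //.
Qed.

(** The induction carries two consecutive levels, since the step uses the matrix units of both. *)
Lemma tl_rep_faithful_full n : injective (@tl_rep n) /\ tl_units n.
Proof.
suff : (injective (@tl_rep n) /\ tl_units n) /\ (injective (@tl_rep n.+1) /\ tl_units n.+1).
  by case.
elim: n => [|n [[inj0 u0] [inj1 u1]]].
  split; split; [exact: tl_rep_inj0 | exact: tl_units0 | exact: tl_rep_inj1 | exact: tl_units1].
have [E0 E0U] := unit_familyP u0; have [E1 E1U] := unit_familyP u1.
split=> //; split; first exact: (tl_rep_inj_step inj1 E0U E1U).
exact: (tl_units_step E1U).
Qed.

Lemma grade_commutant_tl_rep n (M : End_tpow K n) :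
  (forall f, M * grade_op n f = grade_op n f * M) -> exists x, rho n x = M.
Proof.
have [_ /unit_familyP [E EU]] := tl_rep_faithful_full n.
by move=> /(unit_family_expand EU) ->; eexists.
Qed.

(** * The double centralizer *)

(** A path of length $n$ with $k$ steps up ends at $m=2k-n$. *)
Definition eig n (k : nat) : K := qint (q ^ (k%:Z * 2 - n%:Z)).

Lemma foldl_stepE t p : foldl step t p = t * q ^ ((ct p)%:Z * 2 - (size p)%:Z).
Proof.
elim: p t => [|b p IH] t /=; first by rewrite mul0r subr0 expr0z mulr1.
have stepE : step t b = t * q ^ (b%:Z * 2 - 1).
  by rewrite /step; case: b; rewrite ?mul1r ?mul0r ?sub0r ?exprN1.
rewrite IH stepE -mulrA -expfzDr //; congr (_ * q ^ _).
by rewrite PoszD -[(size p).+1]addn1 PoszD; ring.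
Qed.

Lemma B_op_grade n : B_op n = grade_op n (eig n).
Proof.
apply: mul_pathv_ext => r sr; rewrite grade_op_pathv // B_op_pathv //.
by rewrite foldl_stepE mul1r sr.
Qed.

(** $s-s^{-1}=t-t^{-1}$ factors as $(s-t)(st+1)=0$, and $st$ is a power of $q$, hence not $-1$. *)
Lemma eig_inj n k l : eig n k = eig n l -> k = l.
Proof.
rewrite /eig /qint; set s := q ^ _; set t := q ^ _ => st.
have s0 : s != 0 by rewrite expfz_neq0.
have t0 : t != 0 by rewrite expfz_neq0.
have {}st : s - s^-1 = t - t^-1.
  have qv : (q - q^-1)^-1 != 0 by rewrite invr_eq0 qV_neq0.
  exact: mulIf qv _ _ st.
have : (s - t) * (s * t + 1) = 0.
  have -> : (s - t) * (s * t + 1) = (s * t) * ((s - s^-1) - (t - t^-1)).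
    by field; rewrite s0 t0.
  by rewrite st subrr mulr0.
move/eqP; rewrite mulf_eq0 => /orP[|].
  rewrite subr_eq0 => /eqP eq_st.
  have : q ^ ((k%:Z * 2 - n%:Z) - (l%:Z * 2 - n%:Z)) == 1.
    by rewrite expfzDr // -invr_expz -/s eq_st -/t mulfV.
  rewrite exprz_eq1 // opprB addrA subrK subr_eq0 => /eqP /(mulIf _) H.
  by have [] := H isT.
rewrite addr_eq0 -expfzDr // => H.
by have := exprz_neqN1 ((k%:Z * 2 - n%:Z) + (l%:Z * 2 - n%:Z)); rewrite H.
Qed.

Lemma grade_opM n f g : grade_op n f * grade_op n g = grade_op n (fun k => f k * g k).
Proof.
apply: mul_pathv_ext => r sr; rewrite -mulmxA !grade_op_pathv // -scalemxAr.
by rewrite grade_op_pathv // scalerA mulrC.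
Qed.

Lemma eq_grade_op n f g : (forall k, (k <= n)%N -> f k = g k) -> grade_op n f = grade_op n g.
Proof.
move=> fg; apply: mul_pathv_ext => r sr; rewrite !grade_op_pathv // fg //.
by rewrite -sr count_size.
Qed.

Lemma grade_op_lin n k f g :
  k *: grade_op n f + grade_op n g = grade_op n (fun i => k * f i + g i).
Proof.
apply: mul_pathv_ext => r sr; rewrite mulmxDl -scalemxAl !grade_op_pathv //.
by rewrite scalerA -scalerDl.
Qed.

Lemma grade_op1 n : grade_op n (fun=> 1) = 1.
Proof. by apply: mul_pathv_ext => r sr; rewrite grade_op_pathv // scale1r mul1mx. Qed.

Local Notation genB n := (subalgebra_gen [set M : End_tpow K n | M = B_op n]).

(* Lagrange interpolation at the eigenvalues of [B_op n]. *)
Lemma grade_op_genB n f : genB n (grade_op n f).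
Proof.
have prodG (s : seq nat) (c d : nat -> K) :
    genB n (grade_op n (fun i => \prod_(j <- s) (c j * eig n i + d j))).
  elim: s => [|j s IH].
    rewrite (@eq_grade_op _ _ (fun=> 1)) => [|i _]; last by rewrite big_nil.
    by rewrite grade_op1; apply: subalgebra_1.
  rewrite (@eq_grade_op _ _ (fun i => (c j * eig n i + d j) *
      \prod_(j <- s) (c j * eig n i + d j))) => [|i _]; last by rewrite big_cons.
  rewrite -grade_opM; apply: subalgebra_mul IH.
  rewrite -(grade_op_lin _ (c j) (eig n) (fun=> d j)) -B_op_grade.
  apply: subalgebra_lin; first exact: subalgebra_in.
  rewrite (@eq_grade_op _ _ (fun=> d j * 1 + 0)) => [|i _]; last by rewrite mulr1 addr0.
  rewrite -(grade_op_lin _ (d j) (fun=> 1) (fun=> 0)) grade_op1.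
  apply: subalgebra_lin; first exact: subalgebra_1.
  rewrite (@eq_grade_op _ _ (fun=> -1 * 1 + 1)) => [|i _]; last by rewrite mulr1 addNr.
  rewrite -(grade_op_lin _ (-1) (fun=> 1) (fun=> 1)) grade_op1.
  by apply: subalgebra_lin; apply: subalgebra_1.
have deltaG k : genB n (grade_op n (fun i => \prod_(j <- iota 0 n.+1 | j != k)
    ((eig n k - eig n j)^-1 * eig n i + - ((eig n k - eig n j)^-1 * eig n j)))).
  rewrite (@eq_grade_op _ _ (fun i => \prod_(j <- [seq j <- iota 0 n.+1 | j != k])
    ((eig n k - eig n j)^-1 * eig n i + - ((eig n k - eig n j)^-1 * eig n j)))) //.
  by move=> i _; rewrite big_filter.
have sumG (s : seq nat) (h : nat -> nat -> K) : (forall k, genB n (grade_op n (h k))) ->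
    genB n (grade_op n (fun i => \sum_(k <- s) f k * h k i)).
  move=> hG; elim: s => [|k s IH].
    rewrite (@eq_grade_op _ _ (fun i => -1 * h 0%N i + h 0%N i)) => [|i _]; last first.
      by rewrite big_nil mulN1r addNr.
    by rewrite -(grade_op_lin _ (-1) (h 0%N) (h 0%N)); apply: subalgebra_lin.
  rewrite (@eq_grade_op _ _ (fun i => f k * h k i + \sum_(k <- s) f k * h k i)) => [|i _].
    by rewrite -(grade_op_lin _ (f k) (h k)); apply: subalgebra_lin.
  by rewrite big_cons.
have := sumG (iota 0 n.+1) _ deltaG.
rewrite (@eq_grade_op n _ f) // => i i_n.
have iI : i \in iota 0 n.+1 by rewrite mem_iota.
rewrite (bigD1_seq i) ?iota_uniq //= [X in _ + X]big1 ?addr0; last first.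
  move=> k ki; apply/eqP; rewrite mulf_eq0 prodf_seq_eq0; apply/orP; right.
  by apply/hasP; exists i => //; rewrite eq_sym ki subrr eqxx.
rewrite big1 ?mulr1 // => j ji.
rewrite -mulrBr mulVf // subr_eq0; apply/eqP=> /eig_inj ij.
by rewrite ij eqxx in ji.
Qed.

Lemma genB_comm n (M N : End_tpow K n) : M * B_op n = B_op n * M -> genB n N -> M * N = N * M.
Proof.
move=> MB; elim=> [_ ->||k u v _ IHu _ IHv|u v _ IHu _ IHv] //.
- by rewrite mulr1 mul1r.
- by rewrite mulrDr mulrDl -scalerAr -scalerAl IHu IHv.
- by rewrite mulrA IHu -mulrA IHv mulrA.
Qed.

(** An operator that commutes with $B$ commutes with the polynomials in $B$, hence with every
    [grade_op], and so is a combination of matrix units from $\mathrm{TL}(B_n)$. *)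
Lemma B_commutant_tl_rep n (M : End_tpow K n) :
  M * B_op n = B_op n * M <-> exists x, rho n x = M.
Proof.
split=> [MB|[x <-]]; last by rewrite B_op_grade tl_rep_grade.
by apply: grade_commutant_tl_rep => f; apply/(genB_comm MB)/grade_op_genB.
Qed.

(** Commuting with the matrix units makes [M] diagonal with entries depending only on the number of
    steps up; [f] records the entry at one representative path. *)
Lemma tl_rep_commutant_genB n (M : End_tpow K n) :
  (forall x, M * rho n x = rho n x * M) -> genB n M.
Proof.
move=> MC; have [_ /unit_familyP [E EU]] := tl_rep_faithful_full n.
pose mid k := nseq k true ++ nseq (n - k) false.
pose f k := (pathd n 1 (mid k) *m (M *m pathv n 1 (mid k))) 0 0.
suff -> : M = grade_op n f by apply: grade_op_genB.
apply: mul_pathv_ext => r sr; rewrite grade_op_pathv //.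
have rn : (ct r <= n)%N by rewrite -sr count_size.
have sm : size (mid (ct r)) = n by rewrite size_cat !size_nseq subnKC.
have cm : ct (mid (ct r)) = ct r by rewrite count_cat !count_nseq /= mul1n mul0n addn0.
have Eu := EU _ _ sr sm (esym cm); set m := mid (ct r) in sm cm Eu *.
(* The vector of [r] is obtained from that of [m] by a matrix unit. Moved to the left of [M], this
   matrix unit keeps only the coefficient of [m] in the image under [M]. *)
have -> : pathv n 1 r = rho n (E r m) *m pathv n 1 m by rewrite Eu // eqxx scale1r.
have H := MC (E r m).
rewrite mulmxA -[M *m _]/(M * _) H -mulmxA [M *m _]pathv_expand mulmx_sumr.
rewrite (@big_tuple_size _ n (fun p => rho n (E r m) *m
  ((pathd n 1 p *m (M *m pathv n 1 m)) 0 0 *: pathv n 1 p)) m) //.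
  by rewrite -scalemxAr.
move=> p sp /negPf pm; rewrite -scalemxAr Eu // eq_sym pm scale0r scaler0 //.
Qed.

(** * The actions of the coideal subalgebra and of the Hecke algebra *)

Section QuantumAction.
Hypothesis qV0 : q - q^-1 != 0.
Local Notation std := (uq_std q0 qV0).
Local Notation act n := (uq_tpow q0 qV0 n).

Let stdE g : std (gen (uq_presentation q) g) = std_letter q g.
Proof. exact: lift_gen. Qed.

Let actS n g : act n.+1 (gen (uq_presentation q) g) = tens_letter std (act n) g.
Proof. exact: lift_gen. Qed.

Let act0 g : act 0 (gen (uq_presentation q) g) = uq_counit _ g.
Proof. exact: lift_gen. Qed.

Let mx2P (A B : 'M[K]_2) : A 0 0 = B 0 0 -> A 0 1 = B 0 1 -> A 1 0 = B 1 0 ->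
  A 1 1 = B 1 1 -> A = B.
Proof. by move=> ? ? ? ?; apply/matrixP; apply: ord2P; apply: ord2P. Qed.

Lemma uq_std_Ki : std (uKi q) = kinv2.
Proof.
rewrite rmorphM /= !stdE; apply: mx2P;
  rewrite /kinv2 !mxE !big_ord_recl !big_ord0 !mxE /= !big_ord_recl !big_ord0 !mxE /=; ring.
Qed.

Lemma uq_std_KKi : std (uK q * uKi q) = 1.
Proof.
rewrite !rmorphM /= !stdE; apply: mx2P;
  rewrite !mxE /= !big_ord_recl !big_ord0 !mxE /= !big_ord_recl !big_ord0 !mxE /=
    !big_ord_recl !big_ord0 !mxE /=; by field.
Qed.

Lemma uq_std_B : std (uB q) = @hecke_s0 K.
Proof.
rewrite rmorphD /= linearZ /= rmorphM /= uq_std_Ki !stdE; apply: mx2P;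
  rewrite /kinv2 /hecke_s0 !mxE /= !big_ord_recl !big_ord0 !mxE /=
    !big_ord_recl !big_ord0 !mxE /=; by field.
Qed.

Lemma uq_std_C : std (uC q) = q *: 1.
Proof.
rewrite rmorphM /= !stdE; apply: mx2P;
  rewrite !mxE /= !big_ord_recl !big_ord0 !mxE /= !big_ord_recl !big_ord0 !mxE /=; ring.
Qed.

Lemma uq_std_Ci : std (uCi q) = q^-1 *: 1.
Proof.
rewrite rmorphM /= !stdE; apply: mx2P;
  rewrite !mxE /= !big_ord_recl !big_ord0 !mxE /= !big_ord_recl !big_ord0 !mxE /=; ring.
Qed.

Let tM n (A B : 'M[K]_2) (C D : End_tpow K n) :
  (A *t C : End_tpow K n.+1) * (B *t D : End_tpow K n.+1) = (A *m B) *t (C *m D).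
Proof. exact: tensmx_mul. Qed.

Lemma uq_tpow_Ki n : act n (uKi q) = kinv_op n.
Proof.
elim: n => [|n IH]; first by rewrite rmorphM /= !act0 /= mulr1.
rewrite rmorphM /= !actS /tens_letter /= !big_cons !big_nil !addr0 tM.
by rewrite -IH -uq_std_Ki /uKi !rmorphM.
Qed.

(** Multiplying $\Delta(E)$ by $K^{-1}\otimes K^{-1}$ turns its term $K\otimes E$ into $1\otimes
    EK^{-1}$; together with $\Delta(F)$ this is the recursion of [B_op]. *)
Lemma uq_tpow_B n : act n (uB q) = B_op n.
Proof.
elim: n => [|n IH].
  by rewrite rmorphD /= linearZ /= rmorphM /= !act0 /= mul0r scaler0 addr0.
rewrite rmorphD /= linearZ /= rmorphM /= uq_tpow_Ki !actS /tens_letter /=.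
rewrite !big_cons !big_nil !addr0 mulrDl -uq_tpow_Ki /= !tM !rmorph1.
have sB : @hecke_s0 K = q^-1 *: (std (uE q) *m kinv2) + std (uF q).
  by rewrite -uq_std_B -uq_std_Ki rmorphD /= linearZ /= rmorphM.
have sK : std (uK q) *m kinv2 = 1
  by have := uq_std_KKi; rewrite rmorphM /= uq_std_Ki.
have aB : act n (uB q) = q^-1 *: (act n (uE q) *m act n (uKi q)) + act n (uF q).
  by rewrite rmorphD /= linearZ /= rmorphM.
rewrite sB sK -IH aB [1 *m _]mul1mx.
move: (_ *m kinv2) (std (uF q)) (act n (uKi q)) => A B C.
move: (_ *m _) (act n (uF q)) => D' G.
apply/matrixP=> i j; rewrite !mxE; ring.
Qed.

Let tZ n a b : (a *: 1 : 'M[K]_2) *t (b *: 1 : End_tpow K n) = (a * b) *: (1 : End_tpow K n.+1).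
Proof.
by rewrite -[(1 : End_tpow K n.+1)]tensmx11; apply/matrixP=> i j; rewrite !mxE; ring.
Qed.

Lemma uq_tpow_C n : act n (uC q) = q ^+ n *: 1.
Proof.
elim: n => [|n IH]; first by rewrite rmorphM /= !act0 /= mulr1 scale1r.
rewrite rmorphM /= !actS /tens_letter /= !big_cons !big_nil !addr0 tM exprS -tZ.
by rewrite -IH -uq_std_C /uC !rmorphM.
Qed.

Lemma uq_tpow_Ci n : act n (uCi q) = q^-1 ^+ n *: 1.
Proof.
elim: n => [|n IH]; first by rewrite rmorphM /= !act0 /= mulr1 scale1r.
rewrite rmorphM /= !actS /tens_letter /= !big_cons !big_nil !addr0 tM exprS -tZ.
by rewrite -IH -uq_std_Ci /uCi !rmorphM.
Qed.

Local Notation genB n := (subalgebra_gen [set M : End_tpow K n | M = B_op n]).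

Lemma subalgebra_genZ (A : algType K) (S : set A) k u : subalgebra_gen S u ->
  subalgebra_gen S (k *: u).
Proof.
have S0 : subalgebra_gen S 0.
  by rewrite -(addNr 1) -scaleN1r; apply: subalgebra_lin; apply: subalgebra_1.
by move=> Su; rewrite -[k *: u]addr0; apply: subalgebra_lin.
Qed.

(** $C^{\pm1}$ acts by the scalar $q^{\pm n}$, so it adds nothing to the algebra generated by
    $B$. *)
Lemma Uiota_image_genB n :
  [set act n u | u in @Uiota K q] = genB n.
Proof.
apply/seteqP; split=> [_ [u Uu <-]|M].
  elim: Uu => [v||k v w _ IHv _ IHw|v w _ IHv _ IHw].
  - case=> ->; rewrite ?uq_tpow_C ?uq_tpow_Ci ?uq_tpow_B;
      by [apply/subalgebra_genZ/subalgebra_1 | apply: subalgebra_in].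
  - by rewrite rmorph1; apply: subalgebra_1.
  - by rewrite linearP; apply: subalgebra_lin.
  - by rewrite rmorphM; apply: subalgebra_mul.
elim=> [_ ->||k v w _ [u Uu <-] _ [u' Uu' <-]|v w _ [u Uu <-] _ [u' Uu' <-]].
- by exists (uB q); [apply: subalgebra_in; constructor 3 | rewrite uq_tpow_B].
- by exists 1; [apply: subalgebra_1 | rewrite rmorph1].
- by exists (k *: u + u'); [apply: subalgebra_lin | rewrite linearP].
- by exists (u * u'); [apply: subalgebra_mul | rewrite rmorphM].
Qed.

End QuantumAction.

(** $H_i$ and $U_i$ differ by the scalar $q^{-1}$, so the two sets of generators have the same span
    together with 1. *)
Lemma hecke_tl_image n :
  range (@hecke_tpow _ _ q0 n) = range (@tl_rep n) :> set (End_tpow K n).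
Proof.
apply/seteqP; split=> [_ [h _ <-]|_ [x _ <-]].
  suff [x <-] : exists x, rho n x = hecke_tpow q0 h by exists x.
  elim/presented_ind: h => [i||k u v [x xE] [y yE]|u v [x xE] [y yE]].
  - rewrite /hecke_tpow lift_gen /hecke_letter; case i0: (i : nat) => [|j].
      by exists (tlgen delta n i); rewrite tl_rep_gen // i0.
    exists (tlgen delta n i + q^-1 *: 1); rewrite linearD /= linearZ /= rmorph1.
    by rewrite tl_rep_gen // i0 subrK.
  - by exists 1; rewrite !rmorph1.
  - by exists (k *: x + y); rewrite !linearP /= xE yE.
  (* The factors are reversed because [hecke_tpow] takes values in the converse algebra. *)
  - by exists (y * x); rewrite !rmorphM /= xE yE.
suff [h hE] : exists h : hecke q n, hecke_tpow q0 h = rho n x by exists h.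
elim/tlB_ind: x => [|i hi|k u v [x xE] [y yE]|u v [x xE] [y yE]].
- by exists 1; rewrite !rmorph1.
- pose g := gen (hecke_presentation q n) (Ordinal hi).
  have gE : hecke_tpow q0 g = hecke_mx q n i by rewrite /hecke_tpow lift_gen.
  rewrite tl_rep_gen //; case: i hi @g gE => [|i] hi g gE; first by exists g.
  exists (g - q^-1 *: 1); rewrite linearB /= linearZ /= rmorph1.
  by rewrite gE.
- by exists (k *: x + y); rewrite !linearP /= xE yE.
- by exists (y * x); rewrite !rmorphM /= xE yE.
Qed.

End PathBasis.

(** * Specialization to $\mathbb{C}(q)$ and conclusion *)

Lemma q_nroot (R : realType) n : q R ^+ n.+1 != 1.
Proof.
rewrite /q -tofracXn -tofrac1 tofrac_eq; apply/eqP=> /(congr1 (fun p : {poly _} => size p)).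
by rewrite size_polyXn size_poly1.
Qed.

Lemma Cq_two_neq0 (R : realType) : 2%:R != 0 :> Cq R.
Proof.
rewrite -[2%:R]/(1 *+ 2) -tofrac1 -tofracMn tofrac_eq0 -polyC_natr.
by rewrite polyC_eq0 Num.Theory.pnatr_eq0.
Qed.

Theorem mainTheorem4 (R : realType) (n : nat) (hn : (1 <= n)%N) :
  [/\ forall (u : uq (q R)) (h : hecke (q R) n) (v : tpow (Cq R) n),
        Uiota u ->
        uq_act (q_neq0 R) (qV_neq R) u (hecke_act (q_neq0 R) v h)
        = hecke_act (q_neq0 R) (uq_act (q_neq0 R) (qV_neq R) u v) h,
      Uiota_image R n = centralizer (hecke_image R n),
      hecke_image R n = centralizer (Uiota_image R n)
    & exists phi : {lrmorphism tlB (- (q R + (q R)^-1)) n -> End_tpow (Cq R) n},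
        injective phi /\ range phi = End_Uiota R n].
Proof.
have qn := @q_nroot R; have two0 := @Cq_two_neq0 R.
have UE : Uiota_image R n = subalgebra_gen [set M | M = B_op (q R) n].
  exact: (Uiota_image_genB (q_neq0 R) (qV_neq R) n).
have HE : hecke_image R n = range (@tl_rep _ _ (q_neq0 R) n).
  exact: (hecke_tl_image (q_neq0 R) n).
(* With the images replaced by that of $\mathrm{TL}(B_n)$ and the algebra generated by $B$, both
   centralizer statements become statements about [B_op]. *)
have comm M N : hecke_image R n M -> Uiota_image R n N -> M * N = N * M.
  rewrite UE HE => -[x _ <-]; apply: genB_comm.
  by apply/(B_commutant_tl_rep (q_neq0 R) qn two0); exists x.
have B_in : Uiota_image R n (B_op (q R) n) by rewrite UE; apply: subalgebra_in.
split.
- move=> u h v Uu; rewrite /uq_act /hecke_act !mulmxA; congr (_ *m v).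
  by symmetry; apply: comm; [exists h | exists u].
- apply/seteqP; split=> [M UM N HN|M MC]; first by rewrite (comm N).
  rewrite UE; apply: (@tl_rep_commutant_genB _ _ (q_neq0 R) qn two0 n M) => x.
  by apply: MC; rewrite HE; exists x.
- apply/seteqP; split=> [M HM N UN|M MC]; first exact: comm.
  rewrite HE; have [x <-] : exists x, tl_rep (q_neq0 R) x = M; last by exists x.
  by apply/(B_commutant_tl_rep (q_neq0 R) qn two0); apply: MC.
exists (@tl_rep _ _ (q_neq0 R) n); split.
  by have [] := tl_rep_faithful_full (q_neq0 R) qn two0 n.
rewrite -[range _]HE; apply/seteqP; split=> [M HM u v Uu|M MC].
  by rewrite /uq_act !mulmxA; congr (_ *m v); apply: comm => //; exists u.
rewrite HE; have [x <-] : exists x, tl_rep (q_neq0 R) x = M; last by exists x.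
apply/(B_commutant_tl_rep (q_neq0 R) qn two0).
(* It suffices to test the condition of [End_Uiota] on one element [u] that acts as $B$. *)
move: B_in => [u Uu <-]; apply: mulv_inj => v.
by have := MC u v Uu; rewrite /uq_act !mulmxA.
Qed.
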